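(* Let $M$ be a smooth manifold of dimension $2n+1$ and let $(E,L)$ be a generalized almost contact structure on $M$ such that $p_E=1$. Then: (i) $(E,L)$ is isomorphic to a generalized almost contact structure represented by a Poon-Wade triple; (ii) if $t_L=1$, then $(E,L)$ is isomorphic to a generalized almost contact structure represented by (the Poon-Wade triple of) an almost cosymplectic structure; (iii) if $t_L=n+1$, then $(E,L)$ is isomorphic to a generalized almost contact structure represented by (the Poon-Wade triple of) an almost contact structure.
   Context: $\mathbb{T}M=TM\oplus T^*M$ carries the inner product $\langle X+\alpha,Y+\beta\rangle=\frac12(\alpha(Y)+\beta(X))$; $a:\mathbb{T}M\to TM$ is the projection (extended complex-linearly when needed). A generalized almost contact structure on an odd-dimensional manifold $M$ is a pair $(E,L)$ where $E\simeq M\times\mathbb{R}^2$ is a trivial subbundle of $\mathbb{T}M$ such that $\langle\ ,\ \rangle|_E$ is nondegenerate of signature $(1,1)$, and $L$ is a maximal isotropic subbundle of $E^\perp\otimes\mathbb{C}$ with $L\cap\overline{L}=0$. Triviality of $E$ is understood as triviality as a bundle with inner product, i.e. $E$ has a global isotropic frame $\mathbf{e}_1,\mathbf{e}_2$ with $\langle\mathbf{e}_1,\mathbf{e}_2\rangle=1/2$. The geometric type of $(E,L)$ at $x\in M$ is $(p_E(x),t_L(x))$, $p_E(x)=\dim a(E_x)$, $t_L(x)=\mathrm{codim}_{\mathbb{C}}\,a(L_x)$ (codimension in $T_xM\otimes\mathbb{C}$). Conditions such as $p_E=1$ mean that equality holds at every point. A triple $(\Phi,\mathbf{e}_1,\mathbf{e}_2)$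 consists of a base-fixing bundle morphism $\Phi:\mathbb{T}M\to\mathbb{T}M$ and sections $\mathbf{e}_1,\mathbf{e}_2\in\Gamma(\mathbb{T}M)$ with $\langle\mathbf{e}_1,\mathbf{e}_1\rangle=\langle\mathbf{e}_2,\mathbf{e}_2\rangle=0$, $\langle\mathbf{e}_1,\mathbf{e}_2\rangle=1/2$, $\Phi^*=-\Phi$ (adjoint with respect to $\langle\ ,\ \rangle$), $\Phi(\mathbf{e}_1)=\Phi(\mathbf{e}_2)=0$, $\Phi^2(\mathbf{x})=-\mathbf{x}+2\langle\mathbf{x},\mathbf{e}_1\rangle\mathbf{e}_2+2\langle\mathbf{x},\mathbf{e}_2\rangle\mathbf{e}_1$. It is a Poon-Wade triple if $\mathbf{e}_1\in\Gamma(TM)$ and $\mathbf{e}_2\in\Gamma(T^*M)$. It represents $(E,L)$ if $E=\mathrm{span}(\mathbf{e}_1,\mathbf{e}_2)$ and $L$ is the $\sqrt{-1}$-eigenbundle of $\Phi$ on $\mathbb{T}M\otimes\mathbb{C}$. Two generalized almost contact structures are isomorphic if one is $(F(E),F(L))$ for $(E,L)$ the other one and $F:\mathbb{T}M\to\mathbb{T}M$ a base-fixing bundle morphism preserving $\langle\ ,\ \rangle$. An almost contact structure $(\phi,\xi,\eta)$ consists of $\phi:TM\to TM$, a vector field $\xi$ and a 1-form $\eta$ with $\eta(\xi)=1$, $\phi(\xi)=0=\phi^*(\eta)$, $\phi^2(X)=-X+\eta(X)\xi$. Its Poon-Wade triple is $\mathbf{e}_1=\xi$, $\mathbf{e}_2=\eta$,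 $\Phi(X+\alpha)=\phi(X)-\phi^*(\alpha)$. An almost cosymplectic structure on $M^{2n+1}$ is a pair $(\theta,\eta)$ of a 2-form and a 1-form with $\theta^n\wedge\eta\ne0$ everywhere. Let $\xi$ be the unique vector field with $\eta(\xi)=1$, $i_\xi\theta=0$, and let $\phi:\mathrm{Ker}(\eta)\to\mathrm{Ann}(\xi)\subset T^*M$ be the isomorphism $\phi(X)=i_X\theta$. Its Poon-Wade triple is $\mathbf{e}_1=\xi$, $\mathbf{e}_2=\eta$, with $\Phi(\mathbf{e}_1)=\Phi(\mathbf{e}_2)=0$ and, on $E^\perp=\mathrm{Ker}(\eta)\oplus\mathrm{Ann}(\xi)$, $\Phi(X+\alpha)=-\phi^{-1}(\alpha)+\phi(X)$. *)

(* Defs.v *)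
From HB Require Import structures.
From mathcomp Require Import all_boot all_order all_algebra all_fingroup.
From mathcomp Require Import complex.
From mathcomp Require Import all_classical all_reals all_analysis.

Set Implicit Arguments.
Unset Strict Implicit.
Unset Printing Implicit Defensive.

Import Order.TTheory GRing.Theory Num.Theory.
Import numFieldNormedType.Exports.

Local Open Scope classical_set_scope.
Local Open Scope ring_scope.

Section SmoothMaps.
Context {R : realType} {V W : normedModType R}.

(* To be used with U open. *)
Fixpoint Ck (k : nat) (U : set V) (f : V -> W) : Prop :=
  if k is k'.+1 then
    (forall x, U x -> differentiable f x) /\
    (forall v : V, Ck k' U (fun x => 'D_v f x))
  else forall x, U x -> {for x, continuous f}.

Definition smooth_on (U : set V) (f : V -> W) : Prop := forall k, Ck k U f.

End SmoothMaps.

(* [coord] and [param] are total; only their values on [dom] and on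
   [coord @` dom] matter. *)
Record chart (R : realType) (m : nat) (T : topologicalType) := Chart {
  dom : set T;
  coord : T -> 'rV[R]_m;
  param : 'rV[R]_m -> T;
  dom_open : open dom;
  codom_open : open (coord @` dom);
  coordK : forall x, dom x -> param (coord x) = x;
  coord_continuous : forall x, dom x -> {for x, continuous coord};
  param_continuous :
    forall p, (coord @` dom) p -> {for p, continuous param}
}.

(* A smooth manifold of dimension m.  The tangent space at x is modelled on
   R^m through the preferred chart [chart_at x]; all the smoothness conditions
   below are stated in every chart of the atlas, through the derivatives of
   the transition maps. *)
Record manifold (R : realType) (m : nat) := Manifold {
  carrier :> topologicalType;
  manifold_hausdorff : hausdorff_space carrier;
  manifold_second_countable : @second_countable carrier;
  atlas : set (chart R m carrier);
  chart_at : carrier -> chart R m carrier;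
  chart_at_atlas : forall x, atlas (chart_at x);
  chart_at_dom : forall x, dom (chart_at x) x;
  atlas_smooth : forall c d, atlas c -> atlas d ->
    smooth_on (coord c @` (dom c `&` dom d)) (coord d \o param c)
}.

Section LinearAlgebra.
Context {K : fieldType} {m : nat}.

(* Vectors X and covectors alpha are both rows, and alpha(X) = X alpha^T. *)
Definition ev (alpha X : 'rV[K]_m) : K := (X *m alpha^T) 0 0.

(* The element X + alpha of TM (+) T*M at a point is [row_mx X alpha], and
   [pairing] is its (K-bilinear) inner product; the projection a is [lsubmx].
   Endomorphisms are square matrices acting on rows on the right. *)
Definition pairing (u v : 'rV[K]_(m + m)) : K :=
  2^-1 * (ev (rsubmx u) (lsubmx v) + ev (rsubmx v) (lsubmx u)).

Definition anchor_image (U : {vspace 'rV[K]_(m + m)}) : {vspace 'rV[K]_m} :=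
  (linfun (fun u : 'rV[K]_(m + m) => lsubmx u) @: U)%VS.

Definition mx_image (A : 'M[K]_(m + m)) (U : {vspace 'rV[K]_(m + m)}) :
    {vspace 'rV[K]_(m + m)} :=
  (linfun (mulmxr A) @: U)%VS.

End LinearAlgebra.

Section Forms.
Context {R : realType} {m : nat}.

Definition form (k : nat) := ('I_k -> 'rV[R]_m) -> R.

Definition wedge p q (a : form p) (b : form q) : form (p + q) := fun v =>
  (p`! * q`!)%:R^-1 * \sum_(s : 'S_(p + q))
    (-1) ^+ s * a (fun i => v (s (lshift q i))) * b (fun j => v (s (rshift p j))).

(* The n-th exterior power; its degree 2 + n * 2 is convertible to n.+1 * 2. *)
Fixpoint wedge_pow (a : form 2) (n : nat) : form (n * 2) :=
  if n is n'.+1 then wedge a (@wedge_pow a n') else fun=> 1.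

Definition form1 (alpha : 'rV[R]_m) : form 1 := fun v => ev alpha (v 0).

(* A 2-form theta is an antisymmetric matrix: theta(X, Y) = X theta Y^T, so
   that i_X theta is the covector [X *m theta]. *)
Definition form2 (theta : 'M[R]_m) : form 2 :=
  fun v => ev (v 0 *m theta) (v 1).

End Forms.

Arguments wedge_pow {R m} a n : rename.

Section Bundles.
Context {R : realType} {m : nat} (M : manifold R m).

Local Notation C := R[i].
Local Notation TT := ('rV[R]_(m + m)).
Local Notation TTC := ('rV[C]_(m + m)).

(* The matrix of the map from T_x M (i.e. R^m through [chart_at x]) to its
   coordinates in the chart c. *)
Definition tangent_coord (c : chart R m M) (x : M) : 'M[R]_m :=
  'J (coord c \o param (chart_at x)) (coord (chart_at x) x).

Definition bigtangent_coord (c : chart R m M) (x : M) : 'M[R]_(m + m) :=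
  let J := tangent_coord c x in block_mx J 0 0 (invmx J)^T.

(* Smoothness on the open set U of a field of geometric objects whose
   expression at x in the chart c is [rep c x]. *)
Definition smooth_in_charts (W : normedModType R) (U : set M)
    (rep : chart R m M -> M -> W) : Prop :=
  forall c, atlas c ->
    smooth_on (coord c @` (U `&` dom c)) (fun p => rep c (param c p)).

Definition smooth_vector_field (X : M -> 'rV[R]_m) : Prop :=
  smooth_in_charts setT (fun c x => X x *m tangent_coord c x).

Definition smooth_one_form (alpha : M -> 'rV[R]_m) : Prop :=
  smooth_in_charts setT (fun c x => alpha x *m (invmx (tangent_coord c x))^T).

Definition smooth_two_form (theta : M -> 'M[R]_m) : Prop :=
  (forall x, (theta x)^T = - theta x) /\
  smooth_in_charts setT (fun c x =>
    let J := tangent_coord c x in invmx J *m theta x *m (invmx J)^T).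

Definition smooth_tangent_endo (phi : M -> 'M[R]_m) : Prop :=
  smooth_in_charts setT (fun c x =>
    let J := tangent_coord c x in invmx J *m phi x *m J).

Definition smooth_section (U : set M) (s : M -> TT) : Prop :=
  smooth_in_charts U (fun c x => s x *m bigtangent_coord c x).

Definition smooth_csection (U : set M) (s : M -> TTC) : Prop :=
  smooth_section U (fun x => map_mx (@complex.Re R) (s x)) /\
  smooth_section U (fun x => map_mx (@complex.Im R) (s x)).

Definition bundle_morphism (F : M -> 'M[R]_(m + m)) : Prop :=
  smooth_in_charts setT (fun c x =>
    let T := bigtangent_coord c x in invmx T *m F x *m T).

Definition cmx (A : 'M[R]_(m + m)) : 'M[C]_(m + m) :=
  map_mx (real_complex R) A.

Definition csubbundle (L : M -> {vspace TTC}) : Prop :=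
  forall x0 : M, exists (k : nat) (s : 'I_k -> M -> TTC) (U : set M),
    [/\ open U, U x0, (forall i, smooth_csection U (s i)) &
        forall x, U x -> basis_of (L x) [seq s i x | i <- enum 'I_k]].

Definition in_perp (E : {vspace TT}) (u : TT) : Prop :=
  forall e, e \in E -> pairing u e = 0.

Definition in_cperp (E : {vspace TT}) (u : TTC) : Prop :=
  in_perp E (map_mx (@complex.Re R) u) /\ in_perp E (map_mx (@complex.Im R) u).

Definition isotropic_in_cperp (E : {vspace TT}) (W : {vspace TTC}) : Prop :=
  (forall u, u \in W -> in_cperp E u) /\
  (forall u v, u \in W -> v \in W -> pairing u v = 0).

Definition isotropic_pair (e1 e2 : M -> TT) : Prop :=
  forall x, [/\ pairing (e1 x) (e1 x) = 0, pairing (e2 x) (e2 x) = 0 &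
                pairing (e1 x) (e2 x) = 2^-1].

(* The global isotropic frame of E makes it a subbundle on which the inner
   product is nondegenerate of signature (1,1). *)
Definition gen_almost_contact
    (E : M -> {vspace TT}) (L : M -> {vspace TTC}) : Prop :=
  [/\ exists e1 e2 : M -> TT,
        [/\ smooth_section setT e1, smooth_section setT e2,
            isotropic_pair e1 e2 &
            forall x, E x = <<[:: e1 x; e2 x]>>%VS],
      csubbundle L,
      forall x, isotropic_in_cperp (E x) (L x) /\
        (forall W : {vspace TTC}, isotropic_in_cperp (E x) W ->
           (L x <= W)%VS -> W = L x) &
      forall x (u : TTC), u \in L x -> map_mx (@conjc R) u \in L x -> u = 0].

Definition type_p (E : M -> {vspace TT}) (x : M) : nat :=
  \dim (anchor_image (E x)).

Definition type_t (L : M -> {vspace TTC}) (x : M) : nat :=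
  (m - \dim (anchor_image (L x)))%N.

Definition triple (Phi : M -> 'M[R]_(m + m)) (e1 e2 : M -> TT) : Prop :=
  [/\ bundle_morphism Phi, smooth_section setT e1, smooth_section setT e2,
      isotropic_pair e1 e2 &
      forall x,
        [/\ forall u v : TT, pairing (u *m Phi x) v = pairing u (- (v *m Phi x)),
            e1 x *m Phi x = 0, e2 x *m Phi x = 0 &
            forall u : TT, u *m Phi x *m Phi x =
              - u + (2 * pairing u (e1 x)) *: e2 x
                  + (2 * pairing u (e2 x)) *: e1 x]].

Definition poon_wade_triple (Phi : M -> 'M[R]_(m + m)) (e1 e2 : M -> TT) : Prop :=
  triple Phi e1 e2 /\ forall x, rsubmx (e1 x) = 0 /\ lsubmx (e2 x) = 0.

Definition represents (Phi : M -> 'M[R]_(m + m)) (e1 e2 : M -> TT)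
    (E : M -> {vspace TT}) (L : M -> {vspace TTC}) : Prop :=
  triple Phi e1 e2 /\
  forall x, E x = <<[:: e1 x; e2 x]>>%VS /\
    (forall u : TTC, u \in L x <-> u *m cmx (Phi x) = 'i%C *: u).

Definition isomorphic (E : M -> {vspace TT}) (L : M -> {vspace TTC})
    (E' : M -> {vspace TT}) (L' : M -> {vspace TTC}) : Prop :=
  exists F : M -> 'M[R]_(m + m),
    [/\ bundle_morphism F,
        forall x (u v : TT), pairing (u *m F x) (v *m F x) = pairing u v &
        forall x, E' x = mx_image (F x) (E x) /\
                  L' x = mx_image (cmx (F x)) (L x)].

Definition almost_contact (phi : M -> 'M[R]_m) (xi eta : M -> 'rV[R]_m) : Prop :=
  [/\ smooth_tangent_endo phi, smooth_vector_field xi, smooth_one_form eta &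
      forall x,
        [/\ ev (eta x) (xi x) = 1, xi x *m phi x = 0, eta x *m (phi x)^T = 0 &
            forall X : 'rV[R]_m,
              X *m phi x *m phi x = - X + ev (eta x) X *: xi x]].

(* In rows, phi^* alpha is alpha phi^T. *)
Definition triple_of_almost_contact (phi : M -> 'M[R]_m) (xi eta : M -> 'rV[R]_m)
    (Phi : M -> 'M[R]_(m + m)) (e1 e2 : M -> TT) : Prop :=
  forall x,
    [/\ e1 x = row_mx (xi x) 0, e2 x = row_mx 0 (eta x) &
        forall X alpha : 'rV[R]_m, row_mx X alpha *m Phi x =
          row_mx (X *m phi x) (- (alpha *m (phi x)^T))].

(* For m = 2n + 1. *)
Definition almost_cosymplectic (n : nat)
    (theta : M -> 'M[R]_m) (eta : M -> 'rV[R]_m) : Prop :=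
  [/\ smooth_two_form theta, smooth_one_form eta &
      forall x, exists v,
        wedge (wedge_pow (form2 (theta x)) n) (form1 (eta x)) v <> 0].

(* xi is determined by its two equations.  With phi(Y) = i_Y theta a bijection
   from Ker eta to Ann xi, Y ranges below over Ker eta and stands for
   phi^-1(alpha), alpha = phi(Y). *)
Definition triple_of_almost_cosymplectic
    (theta : M -> 'M[R]_m) (eta : M -> 'rV[R]_m)
    (Phi : M -> 'M[R]_(m + m)) (e1 e2 : M -> TT) : Prop :=
  exists xi : M -> 'rV[R]_m,
    [/\ smooth_vector_field xi,
        (forall x, ev (eta x) (xi x) = 1 /\ xi x *m theta x = 0) &
        forall x,
          [/\ e1 x = row_mx (xi x) 0, e2 x = row_mx 0 (eta x),
              e1 x *m Phi x = 0, e2 x *m Phi x = 0 &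
              forall X Y alpha : 'rV[R]_m,
                ev (eta x) X = 0 -> ev (eta x) Y = 0 ->
                ev alpha (xi x) = 0 -> Y *m theta x = alpha ->
                row_mx X alpha *m Phi x = row_mx (- Y) (X *m theta x)]].

End Bundles.

(* Main.v *)
From HB Require Import structures.
From mathcomp Require Import all_boot all_order all_algebra all_fingroup.
From mathcomp Require Import complex.
From mathcomp Require Import all_classical all_reals all_analysis.
From mathcomp Require Import ring zify.
Require Import Defs.
Set Implicit Arguments.
Unset Strict Implicit.
Unset Printing Implicit Defensive.
Import Order.TTheory GRing.Theory Num.Theory.
Import numFieldNormedType.Exports.
Local Open Scope ring_scope.

(** Endomorphisms act on rows from the right, so an endomorphism of TM + T*M is
    a block matrix with rows (A, s) and (p, D): A acts on TM, s is a 2-form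
    X |-> i_X s, and p a bivector.

    The condition p_E = 1 forces one section of the isotropic frame of E to be
    a 1-form.  Indeed the tangent parts of e_1 and e_2 cannot both vanish, and
    if both were nonzero they would be proportional, and the pairing of e_1
    with e_2 would vanish ([isotropic_frame_anchor]).  After an exchange on an
    open and closed set ([contact_frame]) one has e_2 = eta and
    e_1 = xi + alpha with eta(xi) = 1 and alpha(xi) = 0, and the B-field
    transformation X + beta |-> X + beta + alpha(X) eta - eta(X) alpha sends
    the frame to xi, eta ([poon_wade_form]).

    It remains to see that a generalized almost contact structure comes from an
    endomorphism Phi ([contact_endomorphism]).  A maximal isotropic L has half
    the dimension of the complexified orthogonal of E
    ([maximal_isotropic_dim]), so that L, its conjugate and E span everything:
    Phi is i on L, - i on the conjugate and 0 on E.  In a local frame of L it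
    is given by an explicit formula that involves the inverse of a Gram matrix,
    and so it is smooth.  Isometric bundle morphisms transport the structure
    and conjugate Phi ([transport_gac], [transport_represents]).

    For a Poon-Wade triple, Phi has blocks A, s, p and - A^T.  If t_L = 1, then
    L contains no covector, so p is invertible from Ann xi to Ker eta
    ([bivector_unit]), and the B-field with B p = A kills A.  What is left is p
    and a 2-form theta, inverse to each other up to sign; theta^n /\ eta does
    not vanish since it is positive on a symplectic basis of Ker eta followed
    by xi ([wedge_pow_symplectic], [wedge_pow_form1]).  If t_L = n + 1, the
    covectors in L, their conjugates and eta span all covectors, so p = 0
    ([bivector_zero]), and the B-field with B = A s / 2 kills s; what is left
    is the triple of the almost contact structure (A, xi, eta). *)

(** * Functions of class C^k on an open set *)

Section Calculus.
Local Open Scope classical_set_scope.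
Context {R : realType}.

(** Differentiability and the differential depend only on the germ: the two
   remainders agree near 0. *)
Lemma near_eq_diff (V W : normedModType R) (f g : V -> W) (a : V) :
  {near a, f =1 g} -> differentiable f a ->
  differentiable g a /\ 'd g a = 'd f a :> (V -> W).
Proof.
move=> fg df; have fga : f a = g a := nbhs_singleton fg.
have exp : g \o shift a = cst (g a) + 'd f a +o_ 0 id.
  have fg0 : \forall h \near 0, f (h + a) = g (h + a).
    have : \near a, f a = g a := fg.
    rewrite (near_shift 0 a)/=.
    by apply: filterS => h /=; rewrite subr0.
  apply/eqaddoP => e e0.
  have /eqaddoP/(_ e e0) fo := diff_locally df.
  by apply: filterS2 fg0 fo => h /= fgh; rewrite !fctE /= fgh fga.
have dgf : 'd g a = 'd f a :> (V -> W).
  by apply: diff_unique => //; exact: diff_continuous.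
split=> //; apply/diff_locallyP; rewrite dgf; split=> //.
exact: diff_continuous.
Qed.

Lemma Ck_continuous (V W : normedModType R) k (U : set V) (f : V -> W) :
  Ck k U f -> forall x, U x -> {for x, continuous f}.
Proof.
case: k => [//|k] [df _] x Ux; exact: differentiable_continuous (df x Ux).
Qed.

Lemma CkS (V W : normedModType R) k (U : set V) (f : V -> W) :
  Ck k.+1 U f -> Ck k U f.
Proof.
elim: k f => [|k IH] f; first by move=> fU; exact: Ck_continuous fU.
by move=> [df Df]; split=> // v; apply: IH; exact: Df.
Qed.

Lemma Ck_subset (V W : normedModType R) k (U U' : set V) (f : V -> W) :
  U' `<=` U -> Ck k U f -> Ck k U' f.
Proof.
move=> UU; elim: k f => [|k IH] f /=; first by move=> fU x /UU; exact: fU.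
by move=> [df Df]; split=> [x /UU|v]; [exact: df|exact/IH/Df].
Qed.

(** [Ck] is imposed on derivatives taken as functions on the whole space, so
   an equality on U must be propagated to the derivatives; this is where
   openness enters, and it is what lets every formula below be replaced by one
   that agrees with it on U only. *)
Lemma Ck_congr (V W : normedModType R) k (U : set V) (f g : V -> W) :
  open U -> {in U, f =1 g} -> Ck k U f -> Ck k U g.
Proof.
move=> oU; have nU x : U x -> forall f g : V -> W, {in U, f =1 g} -> {near x, f =1 g}.
  move=> Ux f' g' fg; have : nbhs x U by exact: open_nbhs_nbhs.
  by apply: filterS => y Uy; apply: fg; rewrite inE.
elim: k f g => [|k IH] f g fg /=.
  move=> fU x Ux; have fgx : f x = g x by apply: fg; rewrite inE.
  rewrite /prop_for /continuous_at -fgx.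
  apply: cvg_trans (fU x Ux).
  by apply: near_eq_cvg; apply: nU.
move=> [df Df]; split=> [x Ux|v].
  by have [] := near_eq_diff (nU x Ux _ _ fg) (df x Ux).
apply: IH (Df v) => x; rewrite inE => Ux; apply: near_eq_derive.
exact: (nU x Ux).
Qed.

Lemma Ck_local (V W : normedModType R) k (U : set V) (f : V -> W) :
  (forall x, U x -> exists2 U' : set V, U' x & Ck k U' f) -> Ck k U f.
Proof.
elim: k f => [|k IH] f fU /=; first by move=> x /fU [U' U'x fU']; exact: fU'.
split=> [x /fU [U' U'x [df _]]|v]; first exact: df.
by apply: IH => x /fU [U' U'x [_ Df]]; exists U'; last exact: Df.
Qed.

Lemma Ck_cst (V W : normedModType R) k (U : set V) (w : W) :
  Ck k U (fun=> w).
Proof.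
elim: k w => [|k IH] w /=; first by move=> x _; exact: cvg_cst.
split=> [x _|v]; first exact: differentiable_cst.
suff -> : (fun x => 'D_v (fun=> w) x) = (fun=> 0 : W) by exact: IH.
by apply/funext => x; exact: derive_cst.
Qed.

Lemma Ck_linear (V W W' : normedModType R) k (U : set V) (f : V -> W)
    (h : {linear W -> W'}) : continuous h -> open U ->
  Ck k U f -> Ck k U (h \o f).
Proof.
move=> ch oU; elim: k f => [|k IH] f /=.
  by move=> fU x Ux; apply: continuous_comp (fU x Ux) _; exact: ch.
move=> [df Df]; split=> [x Ux|v].
  by apply: differentiable_comp (df x Ux) _; exact: linear_differentiable.
apply: Ck_congr (IH _ (Df v)) => // x; rewrite inE => Ux /=.
have dh : differentiable h (f x) by exact: linear_differentiable.
rewrite [RHS]deriveE; last exact: differentiable_comp (df x Ux) dh.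
by rewrite diff_comp ?diff_lin//=; [rewrite deriveE//; exact: df|exact: df].
Qed.

Lemma CkD (V W : normedModType R) k (U : set V) (f g : V -> W) :
  open U -> Ck k U f -> Ck k U g -> Ck k U (f \+ g).
Proof.
move=> oU; elim: k f g => [|k IH] f g /=.
  by move=> fU gU x Ux; apply: cvgD; [exact: fU|exact: gU].
move=> [df Df] [dg Dg]; split=> [x Ux|v].
  by apply: differentiableD; [exact: df|exact: dg].
apply: Ck_congr (IH _ _ (Df v) (Dg v)) => // x; rewrite inE => Ux /=.
by rewrite -deriveD//; apply: diff_derivable; [exact: df|exact: dg].
Qed.

Lemma Ck_sum (V W : normedModType R) k (U : set V) (I : Type) (r : seq I)
    (P : pred I) (f : I -> V -> W) :
  open U -> (forall i, Ck k U (f i)) -> Ck k U (fun x => \sum_(i <- r | P i) f i x).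
Proof.
move=> oU fU; elim: r => [|i r IH].
  by under eq_fun do rewrite big_nil; exact: Ck_cst.
case: (boolP (P i)) => Pi; last first.
  apply: Ck_congr IH => // x _; by rewrite big_cons (negbTE Pi).
apply: Ck_congr (CkD oU (fU i) IH) => // x _; by rewrite big_cons Pi.
Qed.

(** By the Leibniz rule the derivatives of a product involve the factors
   themselves, which are of class C^k because they are of class C^(k+1). *)
Lemma CkM (V : normedModType R) k (U : set V) (f g : V -> R) :
  open U -> Ck k U f -> Ck k U g -> Ck k U (fun x => f x * g x).
Proof.
move=> oU; elim: k f g => [|k IH] f g /=.
  by move=> fU gU x Ux; apply: cvgM; [exact: fU|exact: gU].
move=> fU gU; have [df Df] := fU; have [dg Dg] := gU; split=> [x Ux|v].
  by apply: differentiableM; [exact: df|exact: dg].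
have h := CkD oU (IH _ _ (CkS fU) (Dg v)) (IH _ _ (CkS gU) (Df v)).
apply: Ck_congr h => // x; rewrite inE => Ux /=.
by rewrite deriveM//; apply: diff_derivable; [exact: df|exact: dg].
Qed.

Lemma CkV (V : normedModType R) k (U : set V) (f : V -> R) :
  open U -> (forall x, U x -> f x != 0) -> Ck k U f -> Ck k U (fun x => (f x)^-1).
Proof.
move=> oU f0; elim: k f f0 => [|k IH] f f0 /=.
  by move=> fU x Ux; apply: cvgV; [exact: f0|exact: fU].
move=> fU; have [df Df] := fU; split=> [x Ux|v].
  by apply: differentiableV; [exact: df|exact: f0].
have Vf := IH _ f0 (CkS fU).
have h := CkM oU (CkM oU (Ck_cst k U (-1 : R)) (CkM oU Vf Vf)) (Df v).
apply: Ck_congr h => // x; rewrite inE => Ux /=.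
rewrite deriveV ?f0//; last exact/diff_derivable/df.
by rewrite mulN1r expr2 invfM.
Qed.

Lemma Ck_prod (V : normedModType R) k (U : set V) (I : Type) (r : seq I)
    (P : pred I) (f : I -> V -> R) :
  open U -> (forall i, Ck k U (f i)) -> Ck k U (fun x => \prod_(i <- r | P i) f i x).
Proof.
move=> oU fU; elim: r => [|i r IH].
  by under eq_fun do rewrite big_nil; exact: Ck_cst.
case: (boolP (P i)) => Pi; last first.
  apply: Ck_congr IH => // x _; by rewrite big_cons (negbTE Pi).
apply: Ck_congr (CkM oU (fU i) IH) => // x _; by rewrite big_cons Pi.
Qed.

(** Through the continuous linear maps that read an entry, and that put a
   number in an entry, everything about matrices reduces to scalar
   functions. *)
Lemma Ck_mxP (V : normedModType R) k (U : set V) p q (f : V -> 'M[R]_(p, q)) :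
  open U -> Ck k U f <-> forall i j, Ck k U (fun x => f x i j).
Proof.
move=> oU; split=> [fU i j|fU].
  have @h : {linear 'M[R]_(p, q) -> R}.
    by exists (fun N : 'M[R]_(_, _) => N i j); do 2![eexists]; do ?[constructor];
       rewrite ?mxE// => ? *; rewrite ?mxE//; move=> ?; rewrite !mxE.
  by apply: (Ck_linear (h := h)) fU => //; exact: matrix_normedtype.coord_continuous.
have h i j : Ck k U (fun x => f x i j *: (delta_mx i j : 'M[R]_(p, q))).
  have lin : linear (fun r : R => r *: (delta_mx i j : 'M[R]_(p, q))).
    by move=> a u v; rewrite scalerDl scalerA.
  pose l : {linear R -> 'M[R]_(p, q)} := HB.pack (fun r : R => r *: (delta_mx i j : 'M[R]_(p, q)))
    (GRing.isLinear.Build _ _ _ _ _ lin).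
  apply: (Ck_linear (h := l)) (fU i j) => //.
  move=> r; exact: scalel_continuous.
have hs := Ck_sum (index_enum 'I_p) xpredT oU
  (fun i => Ck_sum (index_enum 'I_q) xpredT oU (h i)).
by apply: Ck_congr hs => // x _; rewrite [RHS]matrix_sum_delta.
Qed.

End Calculus.

(** * Smooth matrix-valued functions *)

Section SmoothMatrices.
Local Open Scope classical_set_scope.
Context {R : realType} {V : normedModType R} (U : set V) (oU : open U).

Lemma smooth_congr (W : normedModType R) (f g : V -> W) :
  {in U, f =1 g} -> smooth_on U f -> smooth_on U g.
Proof. by move=> fg fU k; apply: Ck_congr (fU k). Qed.

Lemma smooth_mxP p q (f : V -> 'M[R]_(p, q)) :
  smooth_on U f <-> forall i j, smooth_on U (fun x => f x i j).
Proof.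
split=> [fU i j k|fU k]; first by apply: (Ck_mxP k f oU).1.
by apply/(Ck_mxP k f oU) => i j; exact: fU.
Qed.

Lemma smooth_addmx p q (f g : V -> 'M[R]_(p, q)) :
  smooth_on U f -> smooth_on U g -> smooth_on U (fun x => f x + g x).
Proof. by move=> fU gU k; exact: CkD. Qed.

Lemma smooth_mulmx p q r (f : V -> 'M[R]_(p, q)) (g : V -> 'M[R]_(q, r)) :
  smooth_on U f -> smooth_on U g -> smooth_on U (fun x => f x *m g x).
Proof.
move=> /smooth_mxP fU /smooth_mxP gU; apply/smooth_mxP => i j k.
under eq_fun do rewrite mxE.
by apply: Ck_sum => // l; apply: CkM => //; [exact: fU|exact: gU].
Qed.

Lemma smooth_trmx p q (f : V -> 'M[R]_(p, q)) :
  smooth_on U f -> smooth_on U (fun x => (f x)^T).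
Proof.
move=> /smooth_mxP fU; apply/smooth_mxP => i j.
by under eq_fun do rewrite mxE; exact: fU.
Qed.

Lemma smooth_det p (f : V -> 'M[R]_p) :
  smooth_on U f -> smooth_on U (fun x => \det (f x)).
Proof.
move=> /smooth_mxP fU k; apply: Ck_sum => // s.
apply: CkM => //; first exact: Ck_cst.
by apply: Ck_prod => // i; exact: fU.
Qed.

Lemma smooth_adj p (f : V -> 'M[R]_p) :
  smooth_on U f -> smooth_on U (fun x => \adj (f x)).
Proof.
move=> /smooth_mxP fU; apply/smooth_mxP => i j k.
under eq_fun do rewrite mxE.
apply: CkM => //; first exact: Ck_cst.
apply: smooth_det; apply/smooth_mxP => a b.
by under eq_fun do rewrite !mxE; exact: fU.
Qed.

(** Cramer's rule: the inverse is the adjugate divided by the determinant, a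
   rational function of the entries. *)
Lemma smooth_invmx p (f : V -> 'M[R]_p) :
  (forall x, U x -> f x \in unitmx) ->
  smooth_on U f -> smooth_on U (fun x => invmx (f x)).
Proof.
move=> unitf fU.
have h : smooth_on U (fun x => (\det (f x))^-1 *: \adj (f x)).
  apply/smooth_mxP => i j k; under eq_fun do rewrite mxE.
  apply: CkM => //.
    apply: CkV => // [x Ux|]; last exact: smooth_det.
    by rewrite -unitfE -unitmxE unitf.
  by move/smooth_adj/smooth_mxP: fU; apply.
apply: smooth_congr h => x; rewrite inE => Ux.
by rewrite /invmx unitf.
Qed.

Lemma smooth_row_mx p q1 q2 (f : V -> 'M[R]_(p, q1)) (g : V -> 'M[R]_(p, q2)) :
  smooth_on U f -> smooth_on U g -> smooth_on U (fun x => row_mx (f x) (g x)).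
Proof.
move=> /smooth_mxP fU /smooth_mxP gU; apply/smooth_mxP => i j.
case: (splitP j) => k jk.
- by rewrite (_ : j = lshift q2 k); [under eq_fun do rewrite row_mxEl; exact: fU|exact: val_inj].
- by rewrite (_ : j = rshift q1 k); [under eq_fun do rewrite row_mxEr; exact: gU|exact: val_inj].
Qed.

Lemma smooth_col_mx p1 p2 q (f : V -> 'M[R]_(p1, q)) (g : V -> 'M[R]_(p2, q)) :
  smooth_on U f -> smooth_on U g -> smooth_on U (fun x => col_mx (f x) (g x)).
Proof.
move=> /smooth_trmx fU /smooth_trmx gU.
have := smooth_trmx (smooth_row_mx fU gU).
by apply: smooth_congr => x _; rewrite tr_row_mx !trmxK.
Qed.

Lemma smooth_lsubmx p q1 q2 (f : V -> 'M[R]_(p, q1 + q2)) :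
  smooth_on U f -> smooth_on U (fun x => lsubmx (f x)).
Proof.
move=> /smooth_mxP fU; apply/smooth_mxP => i j.
by under eq_fun do rewrite mxE; exact: fU.
Qed.

Lemma smooth_rsubmx p q1 q2 (f : V -> 'M[R]_(p, q1 + q2)) :
  smooth_on U f -> smooth_on U (fun x => rsubmx (f x)).
Proof.
move=> /smooth_mxP fU; apply/smooth_mxP => i j.
by under eq_fun do rewrite mxE; exact: fU.
Qed.

Lemma smooth_usubmx p1 p2 q (f : V -> 'M[R]_(p1 + p2, q)) :
  smooth_on U f -> smooth_on U (fun x => usubmx (f x)).
Proof.
move=> /smooth_mxP fU; apply/smooth_mxP => i j.
by under eq_fun do rewrite mxE; exact: fU.
Qed.

Lemma smooth_dsubmx p1 p2 q (f : V -> 'M[R]_(p1 + p2, q)) :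
  smooth_on U f -> smooth_on U (fun x => dsubmx (f x)).
Proof.
move=> /smooth_mxP fU; apply/smooth_mxP => i j.
by under eq_fun do rewrite mxE; exact: fU.
Qed.

Lemma smooth_cstmx p q (N : 'M[R]_(p, q)) : smooth_on U (fun=> N).
Proof. by move=> k; exact: Ck_cst. Qed.

Lemma smooth_rows k q (f : 'I_k -> V -> 'rV[R]_q) :
  (forall i, smooth_on U (f i)) -> smooth_on U (fun x => \matrix_i f i x).
Proof.
move=> fU; apply/smooth_mxP => i j; under eq_fun do rewrite mxE.
by move/smooth_mxP: (fU i); apply.
Qed.

End SmoothMatrices.

(** * Charts and transition Jacobians *)

Section Charts.
Local Open Scope classical_set_scope.
Context {R : realType} {m : nat} (M : manifold R m).

(** The image is the intersection of the open image of the chart with the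
   preimage of U by the continuous inverse chart. *)
Lemma coord_image_open (c : chart R m M) (U : set M) :
  open U -> open (coord c @` (U `&` dom c)).
Proof.
move=> oU; rewrite openE => _ [x [Ux dx] <-].
have xp : nbhs (coord c x) (coord c @` dom c).
  by apply: open_nbhs_nbhs; split; [exact: codom_open|exists x].
have cp : {for coord c x, continuous (param c)}.
  by apply: param_continuous; exists x.
have : nbhs (coord c x) (param c @^-1` U).
  by apply: cp; rewrite coordK//; exact: open_nbhs_nbhs.
apply: filterS2 xp => _ [y dy <-] /=; rewrite coordK// => Uy.
by exists y.
Qed.

(** The chain rule for the two transition maps between the chart c and the
   preferred chart at x, which are inverse to each other near x. *)
Lemma tangent_coord_unit (c : chart R m M) x :
  atlas c -> dom c x -> tangent_coord c x \in unitmx.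
Proof.
move=> ac dcx; set d := chart_at x.
have ad : atlas d := chart_at_atlas x.
have ddx : dom d x := chart_at_dom x.
pose g := coord c \o param d; pose h := coord d \o param c.
have gx : g (coord d x) = coord c x by rewrite /g /= coordK.
have dg : differentiable g (coord d x).
  have /(_ 1%N)[+ _] := atlas_smooth ad ac.
  by apply; exists x.
have dh : differentiable h (g (coord d x)).
  have /(_ 1%N)[+ _] := atlas_smooth ac ad.
  by apply; rewrite gx; exists x.
(* The transition maps are inverse to each other on the overlap, which is
   open. *)
have hg : {near coord d x, id =1 h \o g}.
  have : nbhs (coord d x) (coord d @` (dom c `&` dom d)).
    apply: open_nbhs_nbhs; split; last by exists x.
    exact/coord_image_open/dom_open.
  apply: filterS => _ [y [dcy ddy] <-] /=.
  by rewrite /h /g /= coordK// coordK.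
have did : differentiable (@id 'rV[R]_m) (coord d x) by [].
have [_ hgE] := near_eq_diff hg did.
have idE : 'd (@id 'rV[R]_m) (coord d x) = id :> (_ -> _).
  have h0 := @is_diff_id R 'rV[R]_m (coord d x).
  have h1 := @diff_val _ _ _ _ _ _ _ h0.
  exact: h1.
have cE : 'd (h \o g) (coord d x) = 'd h (g (coord d x)) \o 'd g (coord d x) :> (_ -> _).
  exact: diff_comp.
have dK v : 'd h (g (coord d x)) ('d g (coord d x) v) = v.
  by rewrite -[LHS]/((_ \o _) v) -cE hgE idE.
have JJ : tangent_coord c x *m 'J h (g (coord d x)) = 1%:M.
  apply/row_matrixP => i; rewrite !rowE mulmx1 mulmxA.
  have -> : delta_mx 0 i *m tangent_coord c x = 'd g (coord d x) (delta_mx 0 i).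
    exact: mul_rV_lin1.
  rewrite -[RHS]dK; exact: mul_rV_lin1.
have [u _] := mulmx1_unit JJ; exact: u.
Qed.

End Charts.

(** * The canonical pairing as a matrix *)

Section Pairing.
Context {K : fieldType} {m : nat}.
Implicit Types (u v w : 'rV[K]_(m + m)) (X Y alpha beta : 'rV[K]_m).

Lemma evE alpha X : ev alpha X = \sum_i alpha 0 i * X 0 i.
Proof. by rewrite /ev mxE; apply: eq_bigr => i _; rewrite mxE mulrC. Qed.

Lemma evC alpha X : ev alpha X = ev X alpha.
Proof. by rewrite !evE; apply: eq_bigr => i _; rewrite mulrC. Qed.

Lemma evDl alpha beta X : ev (alpha + beta) X = ev alpha X + ev beta X.
Proof. by rewrite /ev linearD mulmxDr mxE. Qed.
Lemma evDr alpha X Y : ev alpha (X + Y) = ev alpha X + ev alpha Y.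
Proof. by rewrite /ev mulmxDl mxE. Qed.
Lemma evZl a alpha X : ev (a *: alpha) X = a * ev alpha X.
Proof. by rewrite /ev linearZ /= -scalemxAr mxE. Qed.
Lemma evZr a alpha X : ev alpha (a *: X) = a * ev alpha X.
Proof. by rewrite /ev -scalemxAl mxE. Qed.
Lemma evNl alpha X : ev (- alpha) X = - ev alpha X.
Proof. by rewrite -scaleN1r evZl mulN1r. Qed.
Lemma evNr alpha X : ev alpha (- X) = - ev alpha X.
Proof. by rewrite -scaleN1r evZr mulN1r. Qed.
Lemma ev0l X : ev 0 X = 0.
Proof. by rewrite /ev trmx0 mulmx0 mxE. Qed.
Lemma ev0r alpha : ev alpha 0 = 0.
Proof. by rewrite evC ev0l. Qed.

Lemma mul_tr_ev alpha X : X *m alpha^T = (ev alpha X)%:M.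
Proof. by rewrite [LHS]mx11_scalar. Qed.

Lemma ev_mul alpha X (N : 'M[K]_m) : ev alpha (X *m N) = ev (alpha *m N^T) X.
Proof. by rewrite /ev trmx_mul trmxK mulmxA. Qed.

Lemma mul_rank1 X Y alpha : X *m (alpha^T *m Y) = ev alpha X *: Y.
Proof. by rewrite mulmxA mul_tr_ev mul_scalar_mx. Qed.

Lemma pairing_row X alpha Y beta :
  pairing (row_mx X alpha) (row_mx Y beta) = 2^-1 * (ev alpha Y + ev beta X).
Proof. by rewrite /pairing !row_mxKl !row_mxKr. Qed.

Lemma pairingC u v : pairing u v = pairing v u.
Proof. by rewrite /pairing addrC. Qed.
Lemma pairingDl u v w : pairing (u + v) w = pairing u w + pairing v w.
Proof. by rewrite /pairing !linearD /= evDl evDr -mulrDr addrACA. Qed.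
Lemma pairingZl a u w : pairing (a *: u) w = a * pairing u w.
Proof. by rewrite /pairing !linearZ /= evZl evZr -mulrDr mulrCA. Qed.
Lemma pairingNl u w : pairing (- u) w = - pairing u w.
Proof. by rewrite -scaleN1r pairingZl mulN1r. Qed.
Lemma pairing0l w : pairing 0 w = 0.
Proof. by rewrite -(scale0r 0) pairingZl mul0r. Qed.
Lemma pairingDr u v w : pairing w (u + v) = pairing w u + pairing w v.
Proof. by rewrite !(pairingC w) pairingDl. Qed.
Lemma pairingZr a u w : pairing w (a *: u) = a * pairing w u.
Proof. by rewrite !(pairingC w) pairingZl. Qed.
Lemma pairingNr u w : pairing w (- u) = - pairing w u.
Proof. by rewrite !(pairingC w) pairingNl. Qed.
Lemma pairing0r w : pairing w 0 = 0.
Proof. by rewrite pairingC pairing0l. Qed.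

Definition swapmx : 'M[K]_(m + m) := block_mx 0 1%:M 1%:M 0.

(** Exchanging the tangent and the cotangent half turns the pairing, up to the
   factor 1/2, into the standard scalar product; identities for the pairing
   then become matrix identities. *)
Lemma mul_row_swap u : u *m swapmx = row_mx (rsubmx u) (lsubmx u).
Proof.
by rewrite -{1}[u]hsubmxK mul_row_block !mulmx0 !mulmx1 addr0 add0r.
Qed.

Lemma swapmxK : swapmx *m swapmx = 1%:M.
Proof.
by rewrite mulmx_block !mulmx0 !mul0mx !mulmx1 !addr0 !add0r -scalar_mx_block.
Qed.

Lemma tr_swapmx : swapmx^T = swapmx.
Proof. by rewrite tr_block_mx !trmx0 !trmx1. Qed.

Lemma pairingE u v : pairing u v = 2^-1 * (u *m swapmx *m v^T) 0 0.
Proof.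
rewrite /pairing mul_row_swap -{3}[v]hsubmxK tr_row_mx mul_row_col mxE.
by congr (_ * (_ + _)); rewrite [LHS]evC.
Qed.

Hypothesis two0 : 2 != 0 :> K.

Lemma isometryP (F : 'M[K]_(m + m)) :
  (forall u v, pairing (u *m F) (v *m F) = pairing u v) <->
  F *m swapmx *m F^T = swapmx.
Proof.
split=> [h|h u v]; last first.
  by rewrite !pairingE trmx_mul -[X in _ = _ * (_ *m X *m _) _ _]h !mulmxA.
have entryE (N : 'M[K]_(m + m)) i j :
    ((delta_mx 0 i : 'rV_(m + m)) *m N *m (delta_mx 0 j : 'rV_(m + m))^T) 0 0 = N i j.
  by rewrite trmx_delta -rowE -colE !mxE.
have inv2 : (2^-1 : K) != 0 by rewrite invr_eq0.
apply/matrixP => i j; have := h (delta_mx 0 i) (delta_mx 0 j).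
rewrite !pairingE => /(mulfI inv2); rewrite entryE => <-.
by rewrite -entryE trmx_mul !mulmxA.
Qed.

Lemma isometry_unit (F : 'M[K]_(m + m)) :
  F *m swapmx *m F^T = swapmx -> F \in unitmx.
Proof.
move=> h; have : F *m (swapmx *m F^T *m swapmx) = 1%:M by rewrite !mulmxA h swapmxK.
by move=> /mulmx1_unit[].
Qed.

End Pairing.

(** * Smooth tensor fields, chart by chart *)

Section TensorFields.
Local Open Scope classical_set_scope.
Context {R : realType} {m : nat} {M : manifold R m}.

Section Rep.
Context (U : set M) (oU : open U).

Lemma smooth_charts_congr (W : normedModType R) (r r' : chart R m M -> M -> W) :
  (forall c x, atlas c -> U x -> dom c x -> r c x = r' c x) ->
  smooth_in_charts U r -> smooth_in_charts U r'.
Proof.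
move=> rr' h c ac; apply: smooth_congr (h c ac); first exact: coord_image_open.
by move=> p; rewrite inE => -[x [Ux dx] <-]; rewrite coordK// rr'.
Qed.

Lemma smooth_charts_mulmx p q s (f : chart R m M -> M -> 'M[R]_(p, q))
    (g : chart R m M -> M -> 'M[R]_(q, s)) :
  smooth_in_charts U f -> smooth_in_charts U g ->
  smooth_in_charts U (fun c x => f c x *m g c x).
Proof.
by move=> fU gU c ac; apply: smooth_mulmx;
  [exact: coord_image_open|exact: fU|exact: gU].
Qed.

Lemma smooth_charts_addmx p q (f g : chart R m M -> M -> 'M[R]_(p, q)) :
  smooth_in_charts U f -> smooth_in_charts U g ->
  smooth_in_charts U (fun c x => f c x + g c x).
Proof.
by move=> fU gU c ac; apply: smooth_addmx;
  [exact: coord_image_open|exact: fU|exact: gU].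
Qed.

Lemma smooth_charts_cst p q (N : 'M[R]_(p, q)) : smooth_in_charts U (fun _ _ => N).
Proof. by move=> c ac; exact: smooth_cstmx. Qed.

Lemma smooth_charts_scale p q a (f : chart R m M -> M -> 'M[R]_(p, q)) :
  smooth_in_charts U f -> smooth_in_charts U (fun c x => a *: f c x).
Proof.
move=> fU; apply: smooth_charts_congr (smooth_charts_mulmx (smooth_charts_cst a%:M) fU) => c x _ _ _.
exact: mul_scalar_mx.
Qed.

Lemma smooth_charts_trmx p q (f : chart R m M -> M -> 'M[R]_(p, q)) :
  smooth_in_charts U f -> smooth_in_charts U (fun c x => (f c x)^T).
Proof.
by move=> fU c ac; apply: smooth_trmx; [exact: coord_image_open|exact: fU].
Qed.

Lemma smooth_charts_invmx p (f : chart R m M -> M -> 'M[R]_p) :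
  (forall c x, atlas c -> U x -> dom c x -> f c x \in unitmx) ->
  smooth_in_charts U f -> smooth_in_charts U (fun c x => invmx (f c x)).
Proof.
move=> uf fU c ac; apply: smooth_invmx; [exact: coord_image_open| |exact: fU].
by move=> _ [x [Ux dx] <-]; rewrite coordK// uf.
Qed.

Lemma smooth_charts_row_mx p q s (f : chart R m M -> M -> 'M[R]_(p, q))
    (g : chart R m M -> M -> 'M[R]_(p, s)) :
  smooth_in_charts U f -> smooth_in_charts U g ->
  smooth_in_charts U (fun c x => row_mx (f c x) (g c x)).
Proof.
by move=> fU gU c ac; apply: smooth_row_mx;
  [exact: coord_image_open|exact: fU|exact: gU].
Qed.

Lemma smooth_charts_col_mx p q s (f : chart R m M -> M -> 'M[R]_(p, s))
    (g : chart R m M -> M -> 'M[R]_(q, s)) :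
  smooth_in_charts U f -> smooth_in_charts U g ->
  smooth_in_charts U (fun c x => col_mx (f c x) (g c x)).
Proof.
by move=> fU gU c ac; apply: smooth_col_mx;
  [exact: coord_image_open|exact: fU|exact: gU].
Qed.

Lemma smooth_charts_lsubmx p q s (f : chart R m M -> M -> 'M[R]_(p, q + s)) :
  smooth_in_charts U f -> smooth_in_charts U (fun c x => lsubmx (f c x)).
Proof.
by move=> fU c ac; apply: smooth_lsubmx; [exact: coord_image_open|exact: fU].
Qed.

Lemma smooth_charts_rsubmx p q s (f : chart R m M -> M -> 'M[R]_(p, q + s)) :
  smooth_in_charts U f -> smooth_in_charts U (fun c x => rsubmx (f c x)).
Proof.
by move=> fU c ac; apply: smooth_rsubmx; [exact: coord_image_open|exact: fU].
Qed.

Lemma smooth_charts_usubmx p q s (f : chart R m M -> M -> 'M[R]_(p + q, s)) :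
  smooth_in_charts U f -> smooth_in_charts U (fun c x => usubmx (f c x)).
Proof.
by move=> fU c ac; apply: smooth_usubmx; [exact: coord_image_open|exact: fU].
Qed.

Lemma smooth_charts_dsubmx p q s (f : chart R m M -> M -> 'M[R]_(p + q, s)) :
  smooth_in_charts U f -> smooth_in_charts U (fun c x => dsubmx (f c x)).
Proof.
by move=> fU c ac; apply: smooth_dsubmx; [exact: coord_image_open|exact: fU].
Qed.

Lemma smooth_charts_rows k q (f : 'I_k -> chart R m M -> M -> 'rV[R]_q) :
  (forall i, smooth_in_charts U (f i)) ->
  smooth_in_charts U (fun c x => \matrix_i f i c x).
Proof.
by move=> fU c ac; apply: smooth_rows => [|i]; [exact: coord_image_open|exact: fU].
Qed.

Lemma smooth_charts_subset (W : normedModType R) (U' : set M) (r : chart R m M -> M -> W) :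
  U `<=` U' -> smooth_in_charts U' r -> smooth_in_charts U r.
Proof.
move=> UU h c ac k; apply: Ck_subset (h c ac k) => _ [x [Ux dx] <-].
by exists x => //; split=> //; exact: UU.
Qed.

End Rep.

(** Smoothness may be checked on the members of an open cover, because it
   holds at a point as soon as it holds on one of the sets containing it. *)
Lemma smooth_charts_local (W : normedModType R) (r : chart R m M -> M -> W) :
  (forall x, exists2 U : set M, U x & smooth_in_charts U r) ->
  smooth_in_charts setT r.
Proof.
move=> h c ac k; apply: Ck_local => _ [x [_ dx] <-].
by have [U Ux rU] := h x; exists (coord c @` (U `&` dom c)); [exists x|exact: rU].
Qed.

Section Frames.
Context (c : chart R m M) (x : M) (ac : atlas c) (dx : dom c x).
Let J := tangent_coord c x.
Let T := bigtangent_coord c x.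
Let Ju : J \in unitmx := tangent_coord_unit ac dx.

(** Vectors are transformed by J and covectors by its inverse transpose, so
   the change of frame preserves the pairing. Hence every pointwise
   construction made from the pairing has the same expression in all charts. *)
Lemma bigtangent_isometry : T *m swapmx *m T^T = swapmx.
Proof.
rewrite /T /bigtangent_coord -/J tr_block_mx !trmx0 trmxK !mulmx_block.
rewrite !(mulmx0, mul0mx, mulmx1, addr0, add0r) mulmxV//.
by rewrite -trmx_mul mulmxV// trmx1.
Qed.

Lemma bigtangent_unit : T \in unitmx.
Proof. exact: isometry_unit bigtangent_isometry. Qed.

Lemma bigtangent_inv : invmx T = block_mx (invmx J) 0 0 J^T.
Proof.
have h : T *m block_mx (invmx J) 0 0 J^T = 1%:M.
  rewrite /T /bigtangent_coord -/J mulmx_block.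
  rewrite !(mulmx0, mul0mx, mulmx1, addr0, add0r) mulmxV//.
  by rewrite -trmx_mul mulmxV// trmx1 -scalar_mx_block.
by rewrite -[RHS](mulKmx bigtangent_unit) h mulmx1.
Qed.

Lemma bigtangent_row (X alpha : 'rV[R]_m) :
  row_mx X alpha *m T = row_mx (X *m J) (alpha *m (invmx J)^T).
Proof. by rewrite mul_row_block !mulmx0 addr0 add0r. Qed.

Lemma bigtangent_block (A s p D : 'M[R]_m) :
  invmx T *m block_mx A s p D *m T =
  block_mx (invmx J *m A *m J) (invmx J *m s *m (invmx J)^T)
           (J^T *m p *m J) (J^T *m D *m (invmx J)^T).
Proof.
rewrite bigtangent_inv {1}/T /bigtangent_coord -/J !mulmx_block.
by rewrite !(mulmx0, mul0mx, addr0, add0r).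
Qed.

End Frames.

(** The local version of [bundle_morphism], for constructions that involve a
   local frame of L. *)
Definition morphism_on (U : set M) (F : M -> 'M[R]_(m + m)) : Prop :=
  smooth_in_charts U (fun c x =>
    let T := bigtangent_coord c x in invmx T *m F x *m T).

Section Algebra.
Context (U : set M) (oU : open U).

Lemma section_mul s F :
  smooth_section U s -> morphism_on U F -> smooth_section U (fun x => s x *m F x).
Proof.
move=> hs hF; apply: smooth_charts_congr (smooth_charts_mulmx oU hs hF) => // c x ac _ dx.
by rewrite /= !mulmxA mulmxK//; exact: bigtangent_unit.
Qed.

Lemma morphism_mul F G :
  morphism_on U F -> morphism_on U G -> morphism_on U (fun x => F x *m G x).
Proof.
move=> hF hG; apply: smooth_charts_congr (smooth_charts_mulmx oU hF hG) => // c x ac _ dx.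
by rewrite /= !mulmxA mulmxK//; exact: bigtangent_unit.
Qed.

Lemma morphism_inv F : (forall x, F x \in unitmx) ->
  morphism_on U F -> morphism_on U (fun x => invmx (F x)).
Proof.
move=> uF hF; have unitT := bigtangent_unit.
apply: smooth_charts_congr (smooth_charts_invmx oU _ hF) => // c x ac _ dx /=; last first.
  by rewrite !unitmx_mul unitmx_inv !unitT// uF.
set T := bigtangent_coord c x; have uT : T \in unitmx by exact: unitT.
have h : (invmx T *m F x *m T) *m (invmx T *m invmx (F x) *m T) = 1%:M.
  by rewrite !mulmxA mulmxK// mulmxK// mulVmx.
have u : invmx T *m F x *m T \in unitmx by case: (mulmx1_unit h).
by rewrite -[RHS](mulKmx u) h mulmx1.
Qed.

End Algebra.

Section Blocks.
Context {A s p D : M -> 'M[R]_m}.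
Let J := @tangent_coord R m M.

Lemma morphism_block :
  smooth_tangent_endo A ->
  smooth_in_charts setT (fun c x => invmx (J c x) *m s x *m (invmx (J c x))^T) ->
  smooth_in_charts setT (fun c x => (J c x)^T *m p x *m J c x) ->
  smooth_in_charts setT (fun c x => (J c x)^T *m D x *m (invmx (J c x))^T) ->
  bundle_morphism (fun x => block_mx (A x) (s x) (p x) (D x)).
Proof.
move=> hA hs hp hD; have oT : open [set: M] by exact: openT.
apply: smooth_charts_congr (smooth_charts_col_mx oT (smooth_charts_row_mx oT hA hs)
  (smooth_charts_row_mx oT hp hD)) => //.
by move=> c x ac _ dx; rewrite /= bigtangent_block.
Qed.

Lemma block_morphism :
  bundle_morphism (fun x => block_mx (A x) (s x) (p x) (D x)) ->
  [/\ smooth_tangent_endo A,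
  smooth_in_charts setT (fun c x => invmx (J c x) *m s x *m (invmx (J c x))^T) &
  smooth_in_charts setT (fun c x => (J c x)^T *m p x *m J c x)].
Proof.
move=> h; have oT : open [set: M] by exact: openT.
have hu := smooth_charts_usubmx oT h; have hd := smooth_charts_dsubmx oT h.
split.
- apply: smooth_charts_congr (smooth_charts_lsubmx oT hu) => // c x ac _ dx.
  by rewrite /= bigtangent_block// col_mxKu row_mxKl.
- apply: smooth_charts_congr (smooth_charts_rsubmx oT hu) => // c x ac _ dx.
  by rewrite /= bigtangent_block// col_mxKu row_mxKr.
- apply: smooth_charts_congr (smooth_charts_lsubmx oT hd) => // c x ac _ dx.
  by rewrite /= bigtangent_block// col_mxKd row_mxKl.
Qed.

End Blocks.

Lemma section_row (X alpha : M -> 'rV[R]_m) :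
  smooth_section setT (fun x => row_mx (X x) (alpha x)) <->
  smooth_vector_field X /\ smooth_one_form alpha.
Proof.
have oT : open [set: M] by exact: openT.
split=> [h|[hX ha]].
  split; [apply: smooth_charts_congr (smooth_charts_lsubmx oT h)
        |apply: smooth_charts_congr (smooth_charts_rsubmx oT h)] => //.
    by move=> c x ac _ dx; rewrite bigtangent_row row_mxKl.
  by move=> c x ac _ dx; rewrite bigtangent_row row_mxKr.
apply: smooth_charts_congr (smooth_charts_row_mx oT hX ha) => // c x ac _ dx.
by rewrite bigtangent_row.
Qed.

End TensorFields.

Lemma mul_swap_tr0 (K : fieldType) m p (u : 'rV[K]_(m + m)) (N : 'M[K]_(p, m + m)) :
  2 != 0 :> K ->
  (u *m swapmx *m N^T = 0) <-> (forall j, pairing u (row j N) = 0).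
Proof.
move=> two0; have E j : (u *m swapmx *m N^T) 0 j = 2 * pairing u (row j N).
  rewrite pairingE mulrA divff// mul1r rowE trmx_mul trmx_delta mulmxA.
  by rewrite -colE [RHS]mxE.
split=> [h j|h]; last by apply/rowP => j; rewrite E h mulr0 mxE.
by have /eqP := E j; rewrite h mxE eq_sym mulf_eq0 (negbTE two0) => /eqP.
Qed.

(** * The dimension of a maximal isotropic subspace *)

Section MaximalIsotropic.
Context {K : closedFieldType} {m : nat}.
Implicit Types (u v w : 'rV[K]_(m + m)).
Hypothesis two0 : 2 != 0 :> K.

(** Over an algebraically closed field a binary quadratic form has a
   nontrivial zero. *)
Lemma isotropic_combination u v :
  exists a b : K, [/\ (a != 0) || (b != 0) &
    pairing (a *: u + b *: v) (a *: u + b *: v) = 0].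
Proof.
have [v0|v0] := eqVneq (pairing v v) 0.
  by exists 0, 1; rewrite oner_eq0 orbT scale0r add0r scale1r.
(* The coefficients of the equation t^2 = P_0 + P_1 t that expresses that u +
   t v is isotropic. *)
pose P i : K := if i == 0%N then - pairing u u / pairing v v
                else - (2 * pairing u v) / pairing v v.
have [t tE] := @solve_monicpoly K 2 P isT.
exists 1, t; rewrite oner_eq0; split=> //.
rewrite !(pairingDl, pairingDr, pairingZl, pairingZr) (pairingC v u).
move: tE; rewrite !big_ord_recl big_ord0 /P /= => tE.
transitivity (t ^+ 2 * pairing v v + t * 2 * pairing u v + pairing u u); first by ring.
by rewrite tE; field.
Qed.

(** Let L' be the orthogonal of L and of the e_i, of codimension at most dim L
   + 2. If L' exceeded L by two dimensions or more, a complement of L in L'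
   would contain a nonzero isotropic vector, and adding it to L would
   contradict maximality. *)
Lemma maximal_isotropic_dim (e1 e2 : 'rV[K]_(m + m)) (L : {vspace 'rV[K]_(m + m)}) :
  let isotropic (W : {vspace 'rV[K]_(m + m)}) :=
    (forall u, u \in W -> pairing u e1 = 0 /\ pairing u e2 = 0) /\
    (forall u v, u \in W -> v \in W -> pairing u v = 0) in
  isotropic L -> (forall W, isotropic W -> (L <= W)%VS -> W = L) ->
  (m + m <= \dim L + \dim L + 3)%N.
Proof.
move=> isotropic [Le LL] maxL; set k := \dim L.
pose S : 'M[K]_(k, m + m) := \matrix_i (vbasis L)`_i.
pose N := col_mx S (col_mx e1 e2).
pose f := linfun (mulmxr (swapmx *m N^T) : 'rV[K]_(m + m) -> 'rV[K]_(k + (1 + 1))).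
have fE u : f u = u *m swapmx *m N^T by rewrite lfunE /= mulmxA.
pose Wp := lker f.
have LWp : (L <= Wp)%VS.
  apply/subvP => u uL; rewrite memv_ker fE; apply/eqP/mul_swap_tr0 => // j.
  case: (split_ordP j) => i ->; rewrite ?rowKu ?rowKd.
    by rewrite rowK; apply: LL => //; by apply/vbasis_mem/mem_nth; rewrite size_tuple.
  by case: (split_ordP i) => l ->; rewrite ?rowKu ?rowKd !row_id; have [] := Le u uL.
have WpP u : u \in Wp -> [/\ pairing u e1 = 0, pairing u e2 = 0 &
    forall v, v \in L -> pairing u v = 0].
  rewrite memv_ker fE => /eqP/(mul_swap_tr0 _ _ two0) h; split.
  - by have := h (rshift k (lshift 1 0)); rewrite rowKd rowKu row_id.
  - by have := h (rshift k (rshift 1 0)); rewrite rowKd rowKd row_id.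
  move=> v /coord_vbasis ->.
  elim/big_rec: _ => [|i w _ IH]; first exact: pairing0r.
  rewrite pairingDr pairingZr IH addr0.
  by have := h (lshift _ i); rewrite rowKu rowK => ->; rewrite mulr0.
have dimWp : (m + m <= \dim Wp + (k + 2))%N.
  have dimrV r : dim 'rV[K]_r = r by rewrite /dim /= mul1n.
  have := limg_ker_dim f fullv; rewrite capfv dimvf dimrV => kerE.
  have : (\dim (limg f) <= k + 2)%N.
    by apply: leq_trans (dimvS (subvf _)) _; rewrite dimvf dimrV.
  rewrite -/Wp in kerE; move: kerE; set a := \dim Wp; set b := \dim _;
    set d := (m + m)%N; move=> *; lia.
rewrite leqNgt; apply/negP => ltk.
(* A nonzero isotropic vector of D can be added to L, without being in L. *)
pose D := (Wp :\: L)%VS.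
have dimD : (1 < \dim D)%N.
  have := dimv_cap_compl Wp L; rewrite -/D.
  have -> : (Wp :&: L)%VS = L by apply/capv_idPr.
  by rewrite -/k; lia.
pose i0 := Ordinal (ltnW dimD); pose i1 := Ordinal dimD.
pose u := (vbasis D)`_i0; pose v := (vbasis D)`_i1.
have [a [b [ab0 q0]]] := isotropic_combination u v.
set w := a *: u + b *: v in q0.
have wD : w \in D by rewrite rpredD// rpredZ//; apply/vbasis_mem/mem_nth; rewrite size_tuple.
have w0 : w != 0.
  apply/negP => /eqP w0; have := basis_free (vbasisP D).
  move=> /freeP/(_ (fun i => if i == i0 then a else if i == i1 then b else 0)).
  rewrite (bigD1 i0)//= (bigD1 i1)//= big1 => [|i /andP[/negbTE-> /negbTE->]]; last by rewrite scale0r.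
  rewrite addr0 /= -/w w0 => /(_ erefl) h; move: ab0.
  have a0 : a = 0 := h i0; have b0 : b = 0 := h i1.
  by rewrite a0 b0 eqxx.
have wWp : w \in Wp by apply: (subvP (diffvSl _ _)) wD.
have [we1 we2 wL] := WpP w wWp.
clearbody w; have WL : (L + <[w]>)%VS = L.
  apply: maxL; last exact: addvSl.
  split=> [_ /memv_addP[x xL [_ /vlineP[c ->] ->]]|].
    by rewrite !pairingDl !pairingZl we1 we2 mulr0 !addr0; exact: Le.
  move=> _ _ /memv_addP[x xL [_ /vlineP[c ->] ->]] /memv_addP[y yL [_ /vlineP[d ->] ->]].
  rewrite !(pairingDl, pairingDr, pairingZl, pairingZr) (LL x y)// (wL y)// q0.
  rewrite (pairingC x) (wL x)//.
  by rewrite !(mulr0, addr0).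
have wL' : w \in L by rewrite -WL; apply: (subvP (addvSr _ _)); exact: memv_line.
have : w \in (D :&: L)%VS by rewrite memv_cap wL' wD.
by rewrite capv_diff memv0 (negbTE w0).
Qed.
End MaximalIsotropic.

(** * Real and imaginary parts of complex matrices *)

Section ComplexMatrices.
Context {R : realType}.
Local Notation rc := (map_mx (real_complex R)).
Local Notation re := (map_mx (@complex.Re R)).
Local Notation im := (map_mx (@complex.Im R)).

Definition cpx p q (a b : 'M[R]_(p, q)) : 'M[R[i]]_(p, q) := rc a + 'i%C *: rc b.

Lemma re_cpx p q (a b : 'M[R]_(p, q)) : re (cpx a b) = a.
Proof. by apply/matrixP => i j; rewrite !mxE /= mul0r mul1r subr0 addr0. Qed.

Lemma im_cpx p q (a b : 'M[R]_(p, q)) : im (cpx a b) = b.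
Proof. by apply/matrixP => i j; rewrite !mxE /= mul0r mul1r !add0r. Qed.

Lemma cpxE p q (u : 'M[R[i]]_(p, q)) : u = cpx (re u) (im u).
Proof.
apply/matrixP => i j; rewrite !mxE; case: (u i j) => a b /=.
by apply/eqP; rewrite eq_complex /= !mul0r !mul1r subr0 addr0 !add0r !eqxx.
Qed.

Lemma cpx_inj p q (a b c d : 'M[R]_(p, q)) : cpx a b = cpx c d -> a = c /\ b = d.
Proof.
by move=> h; split; [rewrite -(re_cpx a b) h re_cpx|rewrite -(im_cpx a b) h im_cpx].
Qed.

Lemma cpx00 p q : cpx 0 0 = 0 :> 'M[R[i]]_(p, q).
Proof. by rewrite /cpx map_mx0 scaler0 addr0. Qed.

Lemma cpx_row_mx p q1 q2 (a c : 'M[R]_(p, q1)) (b d : 'M[R]_(p, q2)) :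
  cpx (row_mx a b) (row_mx c d) = row_mx (cpx a c) (cpx b d).
Proof. by rewrite /cpx !map_row_mx scale_row_mx add_row_mx. Qed.

Lemma rcE p q (a : 'M[R]_(p, q)) : rc a = cpx a 0.
Proof. by rewrite /cpx map_mx0 scaler0 addr0. Qed.

Lemma cpxN p q (a b : 'M[R]_(p, q)) : - cpx a b = cpx (- a) (- b).
Proof. by rewrite /cpx !map_mxN scalerN opprD. Qed.

Lemma cpxZi p q (a b : 'M[R]_(p, q)) : 'i%C *: cpx a b = cpx (- b) a.
Proof.
have ii : 'i%C * 'i%C = -1 :> R[i] by rewrite -expr2 sqr_i.
by rewrite /cpx scalerDr scalerA ii scaleN1r addrC map_mxN.
Qed.

Lemma cpxM p q r (a b : 'M[R]_(p, q)) (c d : 'M[R]_(q, r)) :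
  cpx a b *m cpx c d = cpx (a *m c - b *m d) (a *m d + b *m c).
Proof.
have ii : 'i%C * 'i%C = -1 :> R[i] by rewrite -expr2 sqr_i.
rewrite /cpx mulmxDl !mulmxDr -!scalemxAl -!scalemxAr scalerA ii scaleN1r.
rewrite map_mxB map_mxD !map_mxM scalerDr.
by rewrite [X in _ + X = _]addrC addrACA.
Qed.

Lemma mul_cpx_rc p q r (a b : 'M[R]_(p, q)) (c : 'M[R]_(q, r)) :
  cpx a b *m rc c = cpx (a *m c) (b *m c).
Proof. by rewrite rcE cpxM !mulmx0 subr0 add0r. Qed.

Lemma conj_cpx p q (a b : 'M[R]_(p, q)) : map_mx (@conjc R) (cpx a b) = cpx a (- b).
Proof.
apply/matrixP => i j; rewrite !mxE /=.
by apply/eqP; rewrite eq_complex /= !(mul0r, mul1r, subr0, addr0, add0r) !eqxx.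
Qed.

Lemma tr_cpx p q (a b : 'M[R]_(p, q)) : (cpx a b)^T = cpx a^T b^T.
Proof. by rewrite /cpx linearD linearZ /= !map_trmx. Qed.

Lemma re_mul_rc p q r (u : 'M[R[i]]_(p, q)) (c : 'M[R]_(q, r)) :
  re (u *m rc c) = re u *m c.
Proof. by rewrite {1}[u]cpxE mul_cpx_rc re_cpx. Qed.

Lemma im_mul_rc p q r (u : 'M[R[i]]_(p, q)) (c : 'M[R]_(q, r)) :
  im (u *m rc c) = im u *m c.
Proof. by rewrite {1}[u]cpxE mul_cpx_rc im_cpx. Qed.

Lemma two_neq0 : 2 != 0 :> R. Proof. by rewrite pnatr_eq0. Qed.
Lemma ctwo_neq0 : 2 != 0 :> R[i]. Proof. by rewrite pnatr_eq0. Qed.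

Lemma rc_swapmx m : swapmx = rc swapmx :> 'M[R[i]]_(m + m).
Proof. by rewrite map_block_mx !map_mx0 !map_mx1. Qed.

Lemma pairing_rc m (u : 'rV[R[i]]_(m + m)) (v : 'rV[R]_(m + m)) :
  pairing u (rc v) = 0 <-> pairing (re u) v = 0 /\ pairing (im u) v = 0.
Proof.
have E (K : fieldType) (a b : 'rV[K]_(m + m)) : 2 != 0 :> K ->
    pairing a b = 0 <-> a *m swapmx *m b^T = 0.
  move=> two0; rewrite pairingE; split=> [/eqP|->]; last by rewrite mxE mulr0.
  by rewrite mulf_eq0 invr_eq0 (negbTE two0) /= => /eqP h; rewrite [LHS]mx11_scalar h raddf0.
rewrite (E _ _ _ ctwo_neq0) !(E _ _ _ two_neq0) {1}[u]cpxE rc_swapmx mul_cpx_rc map_trmx.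
rewrite mul_cpx_rc; split=> [|[-> ->]]; last exact: cpx00.
by rewrite -cpx00 => /cpx_inj.
Qed.

End ComplexMatrices.

(** * The endomorphism of a generalized almost contact structure at a point *)

Section PointwiseEndomorphism.
Context {R : realType} {m : nat}.
Local Notation C := R[i].
Local Notation re := (map_mx (@complex.Re R)).
Local Notation im := (map_mx (@complex.Im R)).
Local Notation TT := ('rV[R]_(m + m)).
Local Notation TTC := ('rV[C]_(m + m)).

Lemma swap_pairing (u v : TT) : u *m swapmx *m v^T = (2 * pairing u v)%:M.
Proof. by rewrite pairingE mulrA divff ?two_neq0// mul1r -mx11_scalar. Qed.

Lemma basis_matrix (K : fieldType) q k (s : 'I_k -> 'rV[K]_q) (L : {vspace 'rV[K]_q}) :
  basis_of L [seq s i | i <- enum 'I_k] ->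
  [/\ \dim L = k, (forall w : 'rV_k, w *m (\matrix_i s i) = 0 -> w = 0) &
      forall u, u \in L <-> exists w : 'rV_k, u = w *m \matrix_i s i].
Proof.
move=> bL; pose X := [tuple s i | i < k].
have XE : [seq s i | i <- enum 'I_k] = X :> seq _ by [].
have Xi (i : 'I_k) : X`_i = s i by rewrite -tnth_nth tnth_mktuple.
have sumE (w : 'rV_k) : w *m (\matrix_i s i) = \sum_i w 0 i *: X`_i.
  by rewrite mulmx_sum_row; apply: eq_bigr => i _; rewrite rowK Xi.
rewrite XE in bL; split.
- exact: size_basis bL.
- move=> w; rewrite sumE; have /freeP/(_ (w 0)) wX := basis_free bL.
  by move=> /wX w0; apply/rowP => i; rewrite mxE w0.
- move=> u; rewrite -(span_basis bL); split=> [/coord_span uE|[w ->]].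
    by eexists (\row_i _); rewrite sumE {1}uE; apply: eq_bigr => i _; rewrite mxE.
  rewrite sumE; apply: rpred_sum => i _; apply: rpredZ.
  by apply/memv_span; rewrite Xi -XE; apply: map_f; rewrite mem_enum.
Qed.

Definition pointwise_represents (Phi : 'M[R]_(m + m)) (e1 e2 : TT)
    (L : {vspace TTC}) : Prop :=
  [/\ forall u v : TT, pairing (u *m Phi) v = pairing u (- (v *m Phi)),
      e1 *m Phi = 0, e2 *m Phi = 0,
      (forall u : TT, u *m Phi *m Phi =
         - u + (2 * pairing u e1) *: e2 + (2 * pairing u e2) *: e1) &
      forall u : TTC, u \in L <-> u *m cmx Phi = 'i%C *: u].

(** Its rows are the images, in coordinates, of a frame Re s_i, Im s_i, e_1,
   e_2 under the wanted endomorphism: if s_i = a_i + i b_i is an eigenvector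
   for i, then a_i goes to - b_i and b_i to a_i, while the e_j are killed. *)
Definition frame_rot k : 'M[R]_(k + k + (1 + 1)) :=
  block_mx (block_mx 0 (- 1%:M) 1%:M 0) 0 0 0.

(** The endomorphism that acts by [frame_rot] on the rows of Q. If the rows of
   Q form a frame, the inverse of Q is [swapmx *m Q^T] times the inverse of
   the Gram matrix. Written so, the formula needs no identification of k + k +
   2 with m + m, is compatible with isometric changes of frame, and is smooth
   in Q. *)
Definition frame_endo k (Q : 'M[R]_(k + k + (1 + 1), m + m)) : 'M[R]_(m + m) :=
  swapmx *m Q^T *m invmx (Q *m swapmx *m Q^T) *m frame_rot k *m Q.

Definition frame_mx k (s : 'I_k -> TTC) (e1 e2 : TT) :
    'M[R]_(k + k + (1 + 1), m + m) :=
  col_mx (col_mx (\matrix_i re (s i)) (\matrix_i im (s i))) (col_mx e1 e2).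

Section Frame.
Context (e1 e2 : TT) (L : {vspace TTC}) (k : nat) (s : 'I_k -> TTC).
Hypothesis (e11 : pairing e1 e1 = 0) (e22 : pairing e2 e2 = 0)
  (e12 : pairing e1 e2 = 2^-1).
Hypothesis isoL : isotropic_in_cperp <<[:: e1; e2]>>%VS L.
Hypothesis maxL : forall W : {vspace TTC},
  isotropic_in_cperp <<[:: e1; e2]>>%VS W -> (L <= W)%VS -> W = L.
Hypothesis conjL : forall u : TTC, u \in L -> map_mx (@conjc R) u \in L -> u = 0.
Hypothesis bL : basis_of L [seq s i | i <- enum 'I_k].

Let S : 'M[C]_(k, m + m) := \matrix_i s i.
Let a : 'M[R]_(k, m + m) := \matrix_i re (s i).
Let b : 'M[R]_(k, m + m) := \matrix_i im (s i).
Let Q := frame_mx s e1 e2.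
Let G := Q *m swapmx *m Q^T.

Let SE : S = cpx a b.
Proof. by rewrite [S]cpxE; congr cpx; apply/matrixP => i j; rewrite !mxE. Qed.

Let memL u : u \in L <-> exists w : 'rV_k, u = w *m S.
Proof. by have [_ _] := basis_matrix bL. Qed.

Let S_free (w : 'rV_k) : w *m S = 0 -> w = 0.
Proof. by have [_ + _] := basis_matrix bL; apply. Qed.

Let in_cperpP u : in_cperp <<[:: e1; e2]>>%VS u <->
  pairing u (map_mx (real_complex R) e1) = 0 /\
  pairing u (map_mx (real_complex R) e2) = 0.
Proof.
have perpP (v : TT) : in_perp <<[:: e1; e2]>>%VS v <->
    pairing v e1 = 0 /\ pairing v e2 = 0.
  split=> [h|[h1 h2] e]; first by split; apply: h; apply: memv_span; rewrite !inE eqxx ?orbT.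
  rewrite span_cons span_seq1 => /memv_addP[_ /vlineP[c ->] [_ /vlineP[d ->] ->]].
  by rewrite pairingDr !pairingZr h1 h2 !mulr0 addr0.
rewrite /in_cperp !perpP !pairing_rc.
by split=> [[[? ?] [? ?]]|[[? ?] [? ?]]].
Qed.

Let row_re i : row i a = re (s i). Proof. exact: rowK. Qed.
Let row_im i : row i b = im (s i). Proof. exact: rowK. Qed.

Let sL i : s i \in L.
Proof. by apply/memL; exists (delta_mx 0 i); rewrite -rowE rowK. Qed.

Let SS : S *m swapmx *m S^T = 0.
Proof.
apply/row_matrixP => i; rewrite row0 !row_mul rowK.
apply/(mul_swap_tr0 _ _ (ctwo_neq0 (R := R))) => j; rewrite rowK.
by apply isoL.2; apply: sL.
Qed.

Let ab : a *m swapmx *m a^T = b *m swapmx *m b^T /\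
  a *m swapmx *m b^T = - (b *m swapmx *m a^T).
Proof.
move: SS; rewrite SE rc_swapmx mul_cpx_rc tr_cpx cpxM -cpx00 => /cpx_inj[h1 h2].
by split; apply/eqP; [rewrite -subr_eq0 h1|rewrite -addr_eq0 h2].
Qed.

Let orth (e : TT) : (forall i, pairing (s i) (map_mx (real_complex R) e) = 0) ->
  a *m swapmx *m e^T = 0 /\ b *m swapmx *m e^T = 0.
Proof.
move=> h; split; apply/row_matrixP => i; rewrite row0 !row_mul ?row_re ?row_im swap_pairing.
  by have /pairing_rc[-> _] := h i; rewrite mulr0 raddf0.
by have /pairing_rc[_ ->] := h i; rewrite mulr0 raddf0.
Qed.

Let orth1 : a *m swapmx *m e1^T = 0 /\ b *m swapmx *m e1^T = 0.
Proof. by apply: orth => i; have /in_cperpP[] := isoL.1 (s i) (sL i). Qed.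
Let orth2 : a *m swapmx *m e2^T = 0 /\ b *m swapmx *m e2^T = 0.
Proof. by apply: orth => i; have /in_cperpP[] := isoL.1 (s i) (sL i). Qed.

Let ab_free (x y : 'rV[R]_k) : x *m a + y *m b = 0 -> x = 0 /\ y = 0.
Proof.
(* The vector w S of L is purely imaginary, so its conjugate - w S is in L
   too. *)
move=> h; pose w := cpx x (- y).
have wS : w *m S = cpx 0 (x *m b - y *m a).
  by rewrite SE cpxM !mulNmx opprK h.
have wL : w *m S \in L by apply/memL; exists w.
have w0 : w = 0.
  apply/S_free/conjL => //; rewrite wS conj_cpx.
  rewrite (_ : cpx 0 _ = - (w *m S)) ?rpredN// wS.
  by rewrite cpxN oppr0.
by move: w0; rewrite -cpx00 => /cpx_inj[-> /eqP]; rewrite oppr_eq0 => /eqP ->.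
Qed.

Let QE (x y : 'rV[R]_k) (g d : 'M[R]_1) : row_mx (row_mx x y) (row_mx g d) *m Q =
  x *m a + y *m b + (g *m e1 + d *m e2).
Proof. by rewrite /Q /frame_mx !mul_row_col. Qed.

Let coef (x y : 'rV[R]_k) (g d : 'M[R]_1) : let u := x *m a + y *m b + (g *m e1 + d *m e2) in
  g = (2 * pairing u e2)%:M /\ d = (2 * pairing u e1)%:M.
Proof.
have two0 := @two_neq0 R.
have pull p (z : 'M[R]_(1, p)) (N : 'M[R]_(p, m + m)) (v : TT) :
    z *m N *m swapmx *m v^T = z *m (N *m swapmx *m v^T) by rewrite !mulmxA.
move=> u; rewrite -!swap_pairing /u !mulmxDl !pull orth1.1 orth1.2 orth2.1 orth2.2.
rewrite !swap_pairing e11 e22 (pairingC e2 e1) e12 divff// !mulr0.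
by rewrite (raddf0 (scalar_mx (n:=1))) !mulmx0 !mulmx1 !addr0 !add0r.
Qed.

Let Q_free (w : 'rV[R]_(k + k + (1 + 1))) : w *m Q = 0 -> w = 0.
Proof.
rewrite -[w]hsubmxK -[lsubmx w]hsubmxK -[rsubmx w]hsubmxK.
move: (lsubmx _) (rsubmx (lsubmx w)) (lsubmx (rsubmx w)) (rsubmx (rsubmx w)).
move=> x y g d; rewrite QE => u0.
have [g0 d0] := coef x y g d.
move: g0 d0; rewrite u0 !pairing0l mulr0 raddf0 => g0 d0.
move: u0; rewrite g0 d0 !mul0mx !addr0 => /ab_free[-> ->].
by rewrite !row_mx0.
Qed.

Let rQ : row_free Q.
Proof.
by rewrite -kermx_eq0; apply/eqP/row_matrixP => i; rewrite row0;
   apply: Q_free; rewrite -row_mul mulmx_ker row0.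
Qed.

(** The frame is free, which bounds k from above; maximality of L bounds it
   from below. These bounds leave 0 and 1 for 2 m - 2 k - 2, which is even. *)
Lemma frame_size : (k + k + (1 + 1))%N = (m + m)%N.
Proof.
have kE : \dim L = k by have [] := basis_matrix bL.
have le1 : (k + k + (1 + 1) <= m + m)%N.
  by move: rQ; rewrite /row_free => /eqP <-; exact: rank_leq_col.
have le2 : (m + m <= \dim L + \dim L + 3)%N.
  apply: (maximal_isotropic_dim (ctwo_neq0 (R := R))
    (e1 := map_mx (real_complex R) e1) (e2 := map_mx (real_complex R) e2)).
    split; last exact: isoL.2.
    by move=> u /isoL.1/in_cperpP.
  move=> W [We WW]; apply: maxL; split=> // u uW; apply/in_cperpP; exact: We.
by move: le2; rewrite kE; lia.
Qed.

Let Q_full : exists Q', Q' *m Q = 1%:M.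
Proof.
by apply/row_fullP; rewrite /row_full (eqP rQ) frame_size.
Qed.

(** The rows of Q span the whole space, on which the pairing is
   nondegenerate. *)
Lemma frame_gram_unit : G \in unitmx.
Proof.
have [Q' Q'Q] := Q_full.
rewrite -row_free_unit -kermx_eq0; apply/eqP/row_matrixP => i; rewrite row0.
apply: Q_free; have : row i (kermx G) *m G = 0 by rewrite -row_mul mulmx_ker row0.
move: (row i _) => w; rewrite /G !mulmxA => wG.
have : w *m Q *m swapmx *m (Q' *m Q)^T *m swapmx = 0.
  by rewrite trmx_mul mulmxA wG !mul0mx.
by rewrite Q'Q trmx1 mulmx1 -mulmxA swapmxK mulmx1.
Qed.

Let Q_endo : Q *m frame_endo Q = frame_rot k *m Q.
Proof. by rewrite /frame_endo !mulmxA mulmxV ?mul1mx//; exact: frame_gram_unit. Qed.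

Let rotQ : frame_rot k *m Q = col_mx (col_mx (- b) a) 0.
Proof.
rewrite /frame_rot /Q /frame_mx !mul_block_col !mul0mx !addr0 add0r.
by rewrite mulNmx !mul1mx.
Qed.

Let Qrow (u : TT) : exists (x y : 'rV[R]_k) (g d : 'M[R]_1), 
  u = x *m a + y *m b + (g *m e1 + d *m e2) /\
  u *m frame_endo Q = y *m a - x *m b.
Proof.
(* The coordinates of u in the frame are read off from a left inverse of Q. *)
have [Q' Q'Q] := Q_full; have uE : u = u *m Q' *m Q by rewrite -mulmxA Q'Q mulmx1.
move: (u *m Q') uE => w; rewrite -[w]hsubmxK -[lsubmx w]hsubmxK -[rsubmx w]hsubmxK.
move: (lsubmx _) (rsubmx (lsubmx w)) (lsubmx (rsubmx w)) (rsubmx (rsubmx w)).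
move=> x y g d uE; exists x, y, g, d; split; first by rewrite uE QE.
rewrite uE -mulmxA Q_endo rotQ !mul_row_col mulmx0 addr0 mulmxN.
by rewrite addrC.
Qed.

Let aPhi : a *m frame_endo Q = - b.
Proof.
have := Q_endo; rewrite rotQ /Q /frame_mx -/Q !mul_col_mx.
by move=> /eq_col_mx[/eq_col_mx[]].
Qed.
Let bPhi : b *m frame_endo Q = a.
Proof.
have := Q_endo; rewrite rotQ /Q /frame_mx -/Q !mul_col_mx.
by move=> /eq_col_mx[/eq_col_mx[]].
Qed.
Let ePhi : e1 *m frame_endo Q = 0 /\ e2 *m frame_endo Q = 0.
Proof.
have := Q_endo; rewrite rotQ /Q /frame_mx -/Q !mul_col_mx.
by move=> /eq_col_mx[_ h]; apply: eq_col_mx; rewrite h col_mx0.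
Qed.

Let skew : frame_endo Q *m swapmx + swapmx *m (frame_endo Q)^T = 0.
Proof.
have [Q' Q'Q] := Q_full.
have cancelQ N : Q *m N *m Q^T = 0 -> N = 0.
  move=> h; have : Q' *m Q *m N *m (Q' *m Q)^T = 0.
    by rewrite trmx_mul -!mulmxA (mulmxA Q) (mulmxA (Q *m N)) h mul0mx mulmx0.
  by rewrite Q'Q trmx1 mul1mx mulmx1.
apply: cancelQ.
have -> : Q *m (frame_endo Q *m swapmx + swapmx *m (frame_endo Q)^T) *m Q^T =
    frame_rot k *m Q *m swapmx *m Q^T + (frame_rot k *m Q *m swapmx *m Q^T)^T.
  rewrite -Q_endo; move: (frame_endo Q) => Phi.
  by rewrite mulmxDr mulmxDl !trmx_mul trmxK tr_swapmx !mulmxA.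
pose P := a *m swapmx *m b^T; pose D := b *m swapmx *m b^T.
have PT : P^T = - P by rewrite {2}/P ab.2 opprK /P !trmx_mul trmxK tr_swapmx mulmxA.
have DT : D^T = D by rewrite /D !trmx_mul trmxK tr_swapmx mulmxA.
have -> : frame_rot k *m Q *m swapmx *m Q^T =
    block_mx (block_mx P (- D) D P) 0 0 0.
  rewrite rotQ !mul_col_mx /Q /frame_mx !tr_col_mx !mul_mx_row -/a -/b !mulNmx.
  rewrite orth1.1 orth1.2 orth2.1 orth2.2 !mul0mx oppr0 !row_mx0 -ab.2 ab.1.
  rewrite -/P -/D [RHS]block_mxEv row_mx0; congr col_mx.
  by rewrite block_mxEv -[0 in RHS]col_mx0 -block_mxEh block_mxEv.
rewrite !tr_block_mx !trmx0 PT linearN /= DT !add_block_mx !addr0 subrr addNr addrN.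
by rewrite !block_mx0.
Qed.

(** Skewness amounts to the antisymmetry of [frame_rot *m G], where G is the
   Gram matrix of the frame; it expresses that the s_i are isotropic and
   orthogonal to the e_j. The other properties are read off from the action on
   the frame. *)
Lemma frame_endo_represents : pointwise_represents (frame_endo Q) e1 e2 L.
Proof.
have [eP1 eP2] := ePhi; split=> //.
- move=> u v; have two0 := @two_neq0 R.
  rewrite pairingNr; apply/eqP; rewrite -addr_eq0; apply/eqP.
  rewrite !pairingE trmx_mul -mulrDr.
  have -> : u *m swapmx *m ((frame_endo Q)^T *m v^T) =
      u *m (swapmx *m (frame_endo Q)^T) *m v^T by rewrite !mulmxA.
  have -> : u *m frame_endo Q *m swapmx *m v^T =
      u *m (frame_endo Q *m swapmx) *m v^T by rewrite !mulmxA.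
  rewrite (_ : _ + _ = (u *m (frame_endo Q *m swapmx + swapmx *m (frame_endo Q)^T) *m v^T) 0 0).
    by rewrite skew mulmx0 mul0mx mxE mulr0.
  by rewrite mulmxDr mulmxDl [in RHS]mxE.
- move=> u; have [x [y [g [d [uE uPhi]]]]] := Qrow u.
  rewrite uPhi mulmxBl -!mulmxA aPhi bPhi mulmxN.
  have := coef x y g d; rewrite /= -uE => -[gE dE].
  rewrite -!mul_scalar_mx -gE -dE {1}uE.
  by rewrite (opprD (_ + _)) -addrA [d *m e2 + _]addrC subrK opprD addrC.
- move=> u; rewrite /cmx; split.
    move=> /memL[w ->]; rewrite SE -mulmxA mul_cpx_rc aPhi bPhi scalemxAr.
    by rewrite cpxZi.
  move=> uPhi; pose u1 := re u; pose u2 := im u.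
  have uc : u = cpx u1 u2 := cpxE u.
  move: uPhi; rewrite uc mul_cpx_rc cpxZi => /cpx_inj[uP1 uP2].
  have [x [y [g [d [u1E u1P]]]]] := Qrow u1.
  have gd0 : g = 0 /\ d = 0.
    have [x' [y' [_ [_ [_ u2P]]]]] := Qrow u2.
    have := coef x y g d; rewrite /= -u1E -uP2 u2P.
    have := coef y' (- x') 0 0; rewrite /= !mul0mx !addr0 mulNmx => -[<- <-].
    by [].
  apply/memL; exists (cpx x (- y)).
  rewrite SE cpxM !mulNmx opprK; congr cpx.
    by rewrite u1E gd0.1 gd0.2 !mul0mx !addr0.
  by rewrite -[LHS]opprK -uP1 u1P opprB.
Qed.

(** An endomorphism with eigenspace L for i acts on the real and imaginary
   parts of the s_i in a prescribed way, and it kills the e_j. *)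
Lemma frame_endo_unique Phi : pointwise_represents Phi e1 e2 L -> Phi = frame_endo Q.
Proof.
move=> [_ Pe1 Pe2 _ PL]; have [Q' Q'Q] := Q_full.
have SP : S *m cmx Phi = 'i%C *: S.
  apply/row_matrixP => i; rewrite row_mul rowK linearZ /= rowK.
  by apply/PL.
move: SP; rewrite SE /cmx mul_cpx_rc cpxZi => /cpx_inj[aP bP].
suff h : Q *m Phi = frame_rot k *m Q.
  by rewrite -[Phi]mul1mx -Q'Q -mulmxA h -Q_endo mulmxA Q'Q mul1mx.
by rewrite rotQ /Q /frame_mx -/a -/b !mul_col_mx aP bP Pe1 Pe2 col_mx0.
Qed.

End Frame.
End PointwiseEndomorphism.

Lemma mx_imageP (K : fieldType) m (A : 'M[K]_(m + m)) (U : {vspace 'rV[K]_(m + m)}) u :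
  A \in unitmx -> u \in mx_image A U = (u *m invmx A \in U).
Proof.
move=> uA; apply/idP/idP => [/memv_imgP[v vU ->]|h].
  by rewrite lfunE /= mulmxK.
by apply/memv_imgP; exists (u *m invmx A); rewrite // lfunE /= mulmxKV.
Qed.

(** * The endomorphism as a smooth bundle morphism *)

Section GlobalEndomorphism.
Local Open Scope classical_set_scope.
Context {R : realType} {m : nat} {M : manifold R m}.
Local Notation C := R[i].
Local Notation re := (map_mx (@complex.Re R)).
Local Notation im := (map_mx (@complex.Im R)).
Local Notation TT := ('rV[R]_(m + m)).
Local Notation TTC := ('rV[C]_(m + m)).

Lemma frame_endo_isometry k (Q : 'M[R]_(k + k + (1 + 1), m + m)) T :
  T *m swapmx *m T^T = swapmx ->
  invmx T *m frame_endo Q *m T = frame_endo (Q *m T).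
Proof.
move=> isoT; have uT := isometry_unit isoT.
have sT : swapmx *m T^T = invmx T *m swapmx by rewrite -{2}isoT !mulmxA mulVmx// mul1mx.
rewrite /frame_endo trmx_mul !mulmxA -(mulmxA Q T) -(mulmxA Q (T *m swapmx)) isoT.
by rewrite sT.
Qed.

Lemma frame_mx_mul k (s : 'I_k -> TTC) (e1 e2 : TT) (T : 'M[R]_(m + m)) :
  frame_mx s e1 e2 *m T =
  col_mx (col_mx (\matrix_i (re (s i) *m T)) (\matrix_i (im (s i) *m T)))
    (col_mx (e1 *m T) (e2 *m T)).
Proof.
rewrite /frame_mx !mul_col_mx; congr (col_mx (col_mx _ _) _);
by apply/row_matrixP => i; rewrite row_mul !rowK.
Qed.

Lemma contact_dim (E : M -> {vspace TT}) (L : M -> {vspace TTC}) x :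
  gen_almost_contact E L -> (\dim (L x) + \dim (L x) + 2)%N = (m + m)%N.
Proof.
move=> [[e1 [e2 [_ _ ie EE]]] sL isoL conjL].
have [k [s [U [_ Ux _ /(_ x Ux) bL]]]] := sL x.
have [-> _ _] := basis_matrix bL.
have [e11 e22 e12] := ie x; have [iL mL] := isoL x; rewrite EE in iL mL.
exact: (frame_size e11 e22 e12 iL mL (conjL x) bL).
Qed.

(** The endomorphism exists and is unique at each point, so the choices made
   at different points agree with the smooth formula given by any local frame
   of L. *)
Lemma contact_endomorphism (E : M -> {vspace TT}) (L : M -> {vspace TTC})
    (e1 e2 : M -> TT) :
  gen_almost_contact E L ->
  smooth_section setT e1 -> smooth_section setT e2 -> isotropic_pair e1 e2 ->
  (forall x, E x = <<[:: e1 x; e2 x]>>%VS) ->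
  exists Phi, represents Phi e1 e2 E L.
Proof.
move=> [_ sL isoL conjL] se1 se2 ie EE.
have local k (s : 'I_k -> M -> TTC) x :
    basis_of (L x) [seq s i x | i <- enum 'I_k] ->
    let Q := frame_mx (s^~ x) (e1 x) (e2 x) in
    [/\ pointwise_represents (frame_endo Q) (e1 x) (e2 x) (L x),
     (forall Phi, pointwise_represents Phi (e1 x) (e2 x) (L x) -> Phi = frame_endo Q) &
     Q *m swapmx *m Q^T \in unitmx].
  move=> bL /=; have [e11 e22 e12] := ie x; have [iL mL] := isoL x.
  rewrite EE in iL mL; split.
  - exact: frame_endo_represents (conjL x) bL.
  - exact: frame_endo_unique (conjL x) bL.
  - exact: frame_gram_unit (conjL x) bL.
have /choice[Phi PhiP] : forall x, exists Phi, pointwise_represents Phi (e1 x) (e2 x) (L x).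
  move=> x; have [k [s [U [_ Ux _ bU]]]] := sL x.
  by have [h _ _] := local k s x (bU x Ux); eexists; exact: h.
exists Phi; split; last by move=> x; have [_ _ _ _ h] := PhiP x; split.
split=> //; last by move=> x; have [? ? ? ? _] := PhiP x; split.
apply: smooth_charts_local => x0; have [k [s [U [oU Ux ss bU]]]] := sL x0.
exists U => //.
pose Q x := frame_mx (s^~ x) (e1 x) (e2 x).
have sQ : smooth_in_charts U (fun c x => Q x *m bigtangent_coord c x).
  have s1 : smooth_in_charts U (fun c x => e1 x *m bigtangent_coord c x).
    by apply: smooth_charts_subset se1.
  have s2 : smooth_in_charts U (fun c x => e2 x *m bigtangent_coord c x).
    by apply: smooth_charts_subset se2.
  have sre := smooth_charts_rows oU (f := fun i c x => re (s i x) *m bigtangent_coord c x)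
    (fun i => (ss i).1).
  have sim := smooth_charts_rows oU (f := fun i c x => im (s i x) *m bigtangent_coord c x)
    (fun i => (ss i).2).
  apply: smooth_charts_congr (smooth_charts_col_mx oU (smooth_charts_col_mx oU sre sim)
    (smooth_charts_col_mx oU s1 s2)) => //.
  by move=> c x _ _ _; rewrite /Q frame_mx_mul.
have sS : smooth_in_charts U (fun _ _ => swapmx : 'M[R]_(m + m)) := smooth_charts_cst U _.
have sD : smooth_in_charts U (fun _ _ => frame_rot k : 'M[R]_(_, _)) := smooth_charts_cst U _.
have sQS := smooth_charts_mulmx oU sS (smooth_charts_trmx oU sQ).
have uG c x : atlas c -> U x -> dom c x ->
    Q x *m bigtangent_coord c x *m swapmx *m (Q x *m bigtangent_coord c x)^T \in unitmx.
  move=> ac Ux' dx; have [_ _] := local k s x (bU x Ux').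
  rewrite -/(Q x); set T := bigtangent_coord c x.
  have -> : Q x *m T *m swapmx *m (Q x *m T)^T = Q x *m (T *m swapmx *m T^T) *m (Q x)^T.
    by rewrite trmx_mul !mulmxA.
  by rewrite bigtangent_isometry.
have sG := smooth_charts_invmx oU uG
  (smooth_charts_mulmx oU (smooth_charts_mulmx oU sQ sS) (smooth_charts_trmx oU sQ)).
have := smooth_charts_mulmx oU (smooth_charts_mulmx oU (smooth_charts_mulmx oU sQS sG) sD) sQ.
apply: smooth_charts_congr => // c x ac Ux' dx.
rewrite /= -/(frame_endo (Q x *m bigtangent_coord c x)).
rewrite -frame_endo_isometry; last exact: bigtangent_isometry.
by have [_ /(_ _ (PhiP x)) <- _] := local k s x (bU x Ux').
Qed.

End GlobalEndomorphism.

(** * Transport by an isometric bundle morphism *)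

Section Transport.
Local Open Scope classical_set_scope.
Context {R : realType} {m : nat} {M : manifold R m}.
Local Notation C := R[i].
Local Notation re := (map_mx (@complex.Re R)).
Local Notation im := (map_mx (@complex.Im R)).
Local Notation TT := ('rV[R]_(m + m)).
Local Notation TTC := ('rV[C]_(m + m)).
Context (E : M -> {vspace TT}) (L : M -> {vspace TTC}) (F : M -> 'M[R]_(m + m)).
Hypothesis (sF : bundle_morphism F)
  (isoF : forall x (u v : TT), pairing (u *m F x) (v *m F x) = pairing u v).

Let E' x := mx_image (F x) (E x).
Let L' x := mx_image (cmx (F x)) (L x).

Let isoFm x : F x *m swapmx *m (F x)^T = swapmx.
Proof. exact/(isometryP (two_neq0 (R := R)) _).1/isoF. Qed.

Let uF x : F x \in unitmx. Proof. exact: isometry_unit (isoFm x). Qed.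

Let isoCF x (u v : TTC) : pairing (u *m cmx (F x)) (v *m cmx (F x)) = pairing u v.
Proof.
move: u v; apply/(isometryP (ctwo_neq0 (R := R)) _).2.
by rewrite /cmx rc_swapmx map_trmx -!map_mxM isoFm.
Qed.

Let uCF x : cmx (F x) \in unitmx.
Proof. by rewrite /cmx map_unitmx. Qed.

Let conjF x (u : TTC) : map_mx (@conjc R) (u *m cmx (F x)) =
  map_mx (@conjc R) u *m cmx (F x).
Proof. by rewrite [u]cpxE /cmx mul_cpx_rc !conj_cpx mul_cpx_rc mulNmx. Qed.

Let cperpF x (u : TTC) : in_cperp (E' x) (u *m cmx (F x)) <-> in_cperp (E x) u.
Proof.
have h (v : TT) : in_perp (E' x) (v *m F x) <-> in_perp (E x) v.
  split=> [h e eE|h e]; first by rewrite -(isoF x) h// mx_imageP// mulmxK.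
  rewrite mx_imageP// => /h; rewrite -(isoF x) => <-.
  by rewrite mulmxKV.
by rewrite /in_cperp /cmx re_mul_rc im_mul_rc !h.
Qed.

Lemma transport_isomorphic : isomorphic E L E' L'.
Proof. by exists F; split. Qed.

Let limg_cmx_basis x k (s : 'I_k -> TTC) :
  basis_of (L x) [seq s i | i <- enum 'I_k] ->
  basis_of (L' x) [seq s i *m cmx (F x) | i <- enum 'I_k].
Proof.
move=> bL; have := @limg_basis_of _ _ _ (linfun (mulmxr (cmx (F x)))) (L x) _ _ bL.
rewrite -map_comp => h.
have -> : [seq s i *m cmx (F x) | i <- enum 'I_k] =
    [seq (linfun (mulmxr (cmx (F x))) \o s) i | i <- enum 'I_k].
  by apply: eq_map => i /=; rewrite lfunE.
apply: h; apply/eqP; rewrite -subv0; apply/subvP => u.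
rewrite memv_cap memv_ker lfunE /= => /andP[_ /eqP uF0].
by rewrite memv0 -(mulmxK (uCF x) u) uF0 mul0mx.
Qed.

Lemma transport_gac : gen_almost_contact E L -> gen_almost_contact E' L'.
Proof.
move=> [[e1 [e2 [se1 se2 ie EE]]] sL isoL conjL]; have oT : open [set: M] by exact: openT.
split.
- exists (fun x => e1 x *m F x), (fun x => e2 x *m F x); split.
  + exact: section_mul.
  + exact: section_mul.
  + by move=> x; rewrite !isoF.
  + by move=> x; rewrite /E' EE /mx_image limg_span /= !lfunE.
- move=> x0; have [k [s [U [oU Ux ss bU]]]] := sL x0.
  exists k, (fun i x => s i x *m cmx (F x)), U; split=> // [i|x Ux'].
    have sFU : morphism_on U F by apply: smooth_charts_subset sF.
    have [sr si] := ss i; split.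
      by apply: smooth_charts_congr (section_mul oU sr sFU) => // c x _ _ _; rewrite /cmx re_mul_rc.
    by apply: smooth_charts_congr (section_mul oU si sFU) => // c x _ _ _; rewrite /cmx im_mul_rc.
  exact: limg_cmx_basis (bU x Ux').
- move=> x; have [[pL iL] mL] := isoL x.
  have L'P u : u \in L' x -> exists2 v, v \in L x & u = v *m cmx (F x).
    by rewrite mx_imageP// => h; exists (u *m invmx (cmx (F x))); rewrite ?mulmxKV.
  split.
    split=> [_ /L'P[u uL ->]|_ _ /L'P[u uL ->] /L'P[v vL ->]].
      exact/cperpF/pL.
    by rewrite isoCF iL.
  move=> W [pW iW] L'W.
  pose W' := mx_image (invmx (cmx (F x))) W.
  have W'P u : u \in W' = (u *m cmx (F x) \in W).
    by rewrite mx_imageP ?unitmx_inv// invmxK.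
  have W'E : W' = L x.
    apply: mL.
      split=> [u|u v]; rewrite !W'P; first by move=> /pW /cperpF.
      by move=> uW vW; rewrite -(isoCF x) iW.
    apply/subvP => u uL; rewrite W'P; apply: (subvP L'W).
    by rewrite mx_imageP// mulmxK.
  by apply/vspaceP => u; rewrite mx_imageP// -W'E W'P mulmxKV.
- move=> x u; rewrite !mx_imageP// => uL cuL.
  rewrite -[u](mulmxKV (uCF x)); rewrite (conjL x (u *m invmx (cmx (F x)))) ?mul0mx//.
  by move: cuL; rewrite -{1}[u](mulmxKV (uCF x)) conjF mulmxK.
Qed.

Lemma transport_represents Phi e1 e2 : represents Phi e1 e2 E L ->
  represents (fun x => invmx (F x) *m Phi x *m F x)
    (fun x => e1 x *m F x) (fun x => e2 x *m F x) E' L'.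
Proof.
have oT : open [set: M] by exact: openT.
move=> [[sP se1 se2 ie hP] hE]; split.
  split.
  - exact: (morphism_mul oT (morphism_mul oT (morphism_inv oT uF sF) sP) sF).
  - exact: section_mul.
  - exact: section_mul.
  - by move=> x; rewrite !isoF.
  move=> x; have [sk P1 P2 PP] := hP x; split.
  - move=> u v; rewrite !mulmxA -{1}[v](mulmxKV (uF x)) isoF sk.
    by rewrite -(isoF x) mulmxKV// mulNmx.
  - by rewrite !mulmxA mulmxK// P1 mul0mx.
  - by rewrite !mulmxA mulmxK// P2 mul0mx.
  - move=> u; rewrite !mulmxA mulmxK// PP !mulmxDl mulNmx mulmxKV// -!scalemxAl.
    by rewrite -!(isoF x (u *m _)) !mulmxKV.
move=> x; have [EE LE] := hE x; split.
  by rewrite /E' EE /mx_image limg_span /= !lfunE.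
move=> u; rewrite mx_imageP// LE.
have -> : u *m cmx (invmx (F x) *m Phi x *m F x) =
    u *m invmx (cmx (F x)) *m cmx (Phi x) *m cmx (F x).
  by rewrite /cmx !map_mxM map_invmx !mulmxA.
have uE : u = u *m invmx (cmx (F x)) *m cmx (F x) by rewrite mulmxKV.
rewrite [X in _ <-> _ = 'i%C *: X]uE scalemxAl; split=> [->//|].
exact: (can_inj (mulmxK (uCF x))).
Qed.

End Transport.

Lemma isomorphic_trans (R : realType) m (M : manifold R m) E1 L1 E2 L2 E3 L3 :
  @isomorphic R m M E1 L1 E2 L2 -> isomorphic E2 L2 E3 L3 -> isomorphic E1 L1 E3 L3.
Proof.
have comp (K : fieldType) (A B : 'M[K]_(m + m)) U : mx_image B (mx_image A U) = mx_image (A *m B) U.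
  rewrite /mx_image -limg_comp; congr lfun_img; apply/lfunP => u.
  by rewrite comp_lfunE !lfunE /= mulmxA.
move=> [F [sF iF h]] [G [sG iG k]]; exists (fun x => F x *m G x); split.
- by apply: morphism_mul => //; exact: openT.
- by move=> x u v; rewrite !mulmxA iG iF.
- move=> x; have [-> ->] := k x; have [-> ->] := h x.
  by rewrite !comp /cmx map_mxM.
Qed.

(** * Nonvanishing of theta^n /\ eta *)

Section WedgePower.
Context {R : realType} {m : nat}.
Local Notation V := ('rV[R]_m).

(** The permutation s deprived of the point i and of its image; the sign
   changes by the parities of these two points, by [odd_lift_perm]. *)
Lemma perm_lift n (s : 'S_n.+1) i : exists s' : 'S_n, s = lift_perm i (s i) s'.
Proof.
pose f k := odflt k (unlift (s i) (s (lift i k))).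
have fE k : lift (s i) (f k) = s (lift i k).
  rewrite /f; case: unliftP => [j -> //|/perm_inj/eqP].
  by rewrite eq_sym (negbTE (neq_lift _ _)).
have f_inj : injective f.
  move=> k l /(congr1 (lift (s i))); rewrite !fE => /perm_inj.
  exact: lift_inj.
exists (perm f_inj); apply/permP => j.
case: (unliftP i j) => [k|] ->; last by rewrite lift_perm_id.
by rewrite lift_perm_lift permE fE.
Qed.

Lemma perm_fix_last N p (s : 'S_N) (l : 'I_p -> 'I_N) (r : 'I_N) :
  N = p.+1 -> (forall i, l i = i :> nat) -> r = p :> nat -> s r = r ->
  exists2 s' : 'S_p, forall i, s (l i) = l (s' i) & s' = s :> bool.
Proof.
move=> e; move: s l r; rewrite e => s l r lE rE sr.
have [s' sE] := perm_lift s r; rewrite sr in sE.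
have ll i : l i = lift r i.
  by apply: val_inj; rewrite /= lE rE /bump leqNgt ltn_ord.
exists s' => [i|]; first by rewrite !ll sE lift_perm_lift.
by rewrite sE odd_lift_perm addbb.
Qed.

(** The sum over all permutations makes a wedge product alternating, whatever
   the two factors are: reindex it. *)
Lemma wedge_perm p q (a : @form R m p) (b : form q) v (s : 'S_(p + q)) :
  wedge a b (fun i => v (s i)) = (-1) ^+ s * wedge a b v.
Proof.
rewrite /wedge mulrCA; congr (_ * _); rewrite big_distrr /=.
rewrite [RHS](reindex_inj (mulIg s)) /=; apply: eq_bigr => t _.
rewrite odd_permM signr_addb -!mulrA [RHS]mulrCA; congr (_ * _).
rewrite [RHS]mulrA -expr2 sqrr_sign mul1r; congr (a _ * b _).
  by apply/funext => i; rewrite permM.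
by apply/funext => i; rewrite permM.
Qed.

Lemma wedge_pow_perm (a : @form R m 2) k v (s : 'S_(k * 2)) :
  wedge_pow a k (fun i => v (s i)) = (-1) ^+ s * wedge_pow a k v.
Proof.
case: k v s => [|k] v s; last exact: wedge_perm.
by rewrite /= (_ : s = 1%g) ?odd_perm1 ?mul1r//; apply/permP => -[].
Qed.

(** Lets a family be replaced by another one with the same symplectic
   products, in particular by a renumbering of part of a symplectic family. *)
Lemma wedge_pow_gram (theta : 'M[R]_m) k (v w : 'I_(k * 2) -> V) :
  (forall i j, ev (v i *m theta) (v j) = ev (w i *m theta) (w j)) ->
  wedge_pow (form2 theta) k v = wedge_pow (form2 theta) k w.
Proof.
elim: k v w => [//|k IH] v w vw /=; rewrite /wedge; congr (_ * _).
apply: eq_bigr => s _; congr (_ * _ * _); first exact: vw.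
by apply: IH => i j; exact: vw.
Qed.

(** The entries of the standard symplectic matrix, for the ordering x_0, y_0,
   x_1, y_1 and so on, indexed by all natural numbers: shifting both indices
   by 2 changes nothing. *)
Definition symplectic_entry (i j : nat) : R :=
  if (j == i.+1) && ~~ odd i then 1 else
  if (i == j.+1) && ~~ odd j then -1 else 0.
Local Notation J := symplectic_entry.

(** Two indices paired by the standard symplectic form are 2 i and 2 i + 1 in
   some order. Removing them and renumbering preserves the entries, and the
   value of the form on the pair is the sign by which the removal changes the
   parity of a permutation. *)
Lemma symplectic_entry_bump (j0 j1 : nat) : J j0 (bump j0 j1) != 0 ->
  J j0 (bump j0 j1) = (-1) ^+ (odd j0 (+) odd j1) /\
  forall x y, J (bump j0 (bump j1 x)) (bump j0 (bump j1 y)) = J x y.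
Proof.
have shift j (e : (j <= bump j j1)%N) x : (bump j (bump j1 x) = bump j1 x + (j <= bump j1 x))%N.
  by rewrite /bump addnC.
rewrite /J; case: ifP => [/andP[/eqP h1 h2] _|_].
  have e : j1 = j0 by move: h1; rewrite /bump; lia.
  rewrite e addbb; split=> // x y.
  rewrite /bump; case: (leqP j0 x) => ?; case: (leqP j0 y) => ? /=;
    do ![case: ifP => ?]; first [done | exfalso; lia].
case: ifP => [/andP[/eqP h1 h2] _|_]; last by rewrite eqxx.
have e : j0 = j1.+1 by move: h1; rewrite /bump; lia.
have o1 : odd j1 = false by move: h2 h1; rewrite /bump; lia.
rewrite e /= o1 addbF; split=> // x y.
rewrite /bump; case: (leqP j1 x) => ?; case: (leqP j1 y) => ? /=;
  do ![case: ifP => ?]; first [done | exfalso; lia].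
Qed.

(** The value on a symplectic family is positive because no term of the
   defining sum is negative. A term is nonzero only if its first two vectors
   are paired; then the value of the form on them equals the sign due to
   moving them to the front, and the sign of the permutation of the others
   cancels against that of the alternating power, whose value is positive by
   induction. *)
Lemma wedge_pow_symplectic (theta : 'M[R]_m) k (v : 'I_(k * 2) -> V) :
  (forall i j, ev (v i *m theta) (v j) = J i j) ->
  0 < wedge_pow (form2 theta) k v.
Proof.
elim: k v => [|k IH] v vJ; first exact: ltr01.
pose r i := rshift 2 i : 'I_(2 + k * 2).
have rE i : r i = lift ord0 (lift ord0 i) by exact: val_inj.
pose c := wedge_pow (form2 theta) k (fun i => v (r i)).
have c0 : 0 < c.
  by apply: IH => i j; rewrite vJ /J /= !add2n !eqSS /= !negbK.
have term (s : 'S_(2 + k * 2)) :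
    (-1) ^+ s * form2 theta (fun i => v (s (lshift (k * 2) i))) *
      wedge_pow (form2 theta) k (fun i => v (s (r i))) =
    `|J (s (lshift _ 0)) (s (lshift _ 1))| * c.
  have l0 : lshift (k * 2) (0 : 'I_2) = ord0 :> 'I_(k * 2).+2 by exact: val_inj.
  have l1 : lshift (k * 2) (1 : 'I_2) = lift ord0 ord0 :> 'I_(k * 2).+2 by exact: val_inj.
  (* Split off the images j0 and j1 of the first two points; p permutes the
     others. *)
  have [s1 sE] := perm_lift (s : 'S_(k * 2).+2) ord0.
  have [p s1E] := perm_lift s1 ord0.
  set j0 := s ord0 in sE; set j1 := s1 ord0 in s1E.
  have s0 : s (lshift _ 0) = j0 by rewrite l0.
  have s1' : s (lshift _ 1) = lift j0 j1 by rewrite l1 sE lift_perm_lift.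
  have sr i : s (r i) = lift j0 (lift j1 (p i)) by rewrite rE sE lift_perm_lift s1E lift_perm_lift.
  rewrite /form2 vJ s0 s1' /=.
  have [->|J0] := eqVneq (J j0 (bump j0 j1)) 0; first by rewrite normr0 mulr0 !mul0r.
  have [JE Jb] := symplectic_entry_bump J0.
  have -> : wedge_pow (form2 theta) k (fun i => v (s (r i))) = (-1) ^+ p * c.
    rewrite -wedge_pow_perm; apply: wedge_pow_gram => i j.
    by rewrite !sr !vJ /= Jb /J /= !add2n !eqSS /= !negbK.
  rewrite JE normr_sign mul1r sE odd_lift_perm s1E odd_lift_perm /=.
  by case: (odd j0); case: (odd j1); case: (odd_perm p); rewrite /= ?expr0 ?expr1; ring.
rewrite /= /wedge; apply: mulr_gt0.
  by rewrite invr_gt0 ltr0n muln_gt0 !fact_gt0.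
rewrite (eq_bigr _ (fun s _ => term s)) -mulr_suml; apply: mulr_gt0 => //.
rewrite (bigD1 1%g) //= !perm1 /= normr1.
by apply: ltr_pwDl => //; apply: sumr_ge0.
Qed.

(** Complete a symplectic family of Ker eta by xi. Only the permutations that
   keep xi in the last place contribute, and by alternation each of them
   contributes the same positive number. *)
Lemma wedge_pow_form1 (theta : 'M[R]_m) (eta : V) n (f : 'I_(n * 2) -> V) (xi : V) :
  (forall i j, ev (f i *m theta) (f j) = J i j) ->
  (forall i, ev eta (f i) = 0) -> ev eta xi = 1 ->
  exists v, wedge (wedge_pow (form2 theta) n) (form1 eta) v <> 0.
Proof.
move=> fJ f0 xi1.
pose v (i : 'I_(n * 2 + 1)) := if fintype.split i is inl j then f j else xi.
have vl i : v (lshift 1 i) = f i by rewrite /v (unsplitK (inl i)).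
have vr i : v (rshift (n * 2) i) = xi by rewrite /v (unsplitK (inr i)).
exists v; apply/eqP; rewrite gt_eqF//; apply: mulr_gt0.
  by rewrite invr_gt0 ltr0n muln_gt0 !fact_gt0.
pose r := rshift (n * 2) (0 : 'I_1); set c := wedge_pow (form2 theta) n f.
have c0 : 0 < c by exact: wedge_pow_symplectic.
rewrite (eq_bigr (fun s : 'S_(n * 2 + 1) => (s r == r)%:R * c)) => [|s _].
  rewrite -mulr_suml; apply: mulr_gt0 => //.
  rewrite (bigD1 1%g) //= perm1 eqxx; apply: ltr_pwDl => //.
  by apply: sumr_ge0 => s _; rewrite ler0n.
rewrite /form1 -/r; have [srr|] := eqVneq (s r) r.
  rewrite srr vr xi1 mulr1 mul1r.
  have [|||s' sE <-] := @perm_fix_last (n * 2 + 1) (n * 2) s (lshift 1) r _ _ _ srr.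
  - by rewrite addn1.
  - by [].
  - by rewrite /= addn0.
  have -> : (fun i => v (s (lshift 1 i))) = (fun i => f (s' i)).
    by apply/funext => i; rewrite sE vl.
  by rewrite wedge_pow_perm mulrA -expr2 sqrr_sign mul1r.
case: (split_ordP (s r)) => j ->; last by rewrite (ord1 j) eqxx.
by move=> _; rewrite vl f0 mulr0 mul0r.
Qed.

(** The usual construction of a symplectic basis: take a pair a, b with
   theta(a, b) = 1 and continue in the orthogonal of a and b, on which theta
   is again nondegenerate. *)
Lemma symplectic_family (theta : 'M[R]_m) k (W : {vspace V}) :
  theta^T = - theta -> (k * 2 <= \dim W)%N ->
  (forall x, x \in W -> (forall y, y \in W -> ev (x *m theta) y = 0) -> x = 0) ->
  exists f : 'I_(k * 2) -> V,
    (forall i, f i \in W) /\ (forall i j, ev (f i *m theta) (f j) = J i j).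
Proof.
move=> tT; have anti x y : ev (x *m theta) y = - ev (y *m theta) x.
  by rewrite evC ev_mul tT mulmxN evNl.
have alt x : ev (x *m theta) x = 0.
  by have /eqP := anti x x; rewrite -subr_eq0 opprK -mulr2n mulrn_eq0 => /eqP.
elim: k W => [|k IH] W dW ndW; first by exists (fun=> 0); split=> -[].
have W0 : W != 0%VS by rewrite -dimv_eq0; lia.
pose a := vpick W; have aW : a \in W by exact: memv_pick.
have [b [bW ab1]] : exists b, b \in W /\ ev (a *m theta) b = 1.
  have /existsNP[y /not_implyP[yW /eqP ay]] : ~ (forall y, y \in W -> ev (a *m theta) y = 0).
    by move=> /(ndW _ aW) /eqP; rewrite vpick0 (negbTE W0).
  by exists ((ev (a *m theta) y)^-1 *: y); rewrite memvZ// evZr mulVf.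
pose h := linfun (mulmxr (row_mx (a *m theta)^T (b *m theta)^T) : V -> 'rV[R]_(1 + 1)).
pose W' := (W :&: lker h)%VS.
have W'P x : x \in W' <-> [/\ x \in W, ev (a *m theta) x = 0 & ev (b *m theta) x = 0].
  rewrite memv_cap memv_ker lfunE /= mul_mx_row !mul_tr_ev; split.
    move=> /andP[xW /eqP]; rewrite -[0]row_mx0 => /eq_row_mx[/matrixP/(_ 0 0) + /matrixP/(_ 0 0)].
    by rewrite !mxE !mulr1n.
  by move=> [-> -> ->]; rewrite !raddf0 row_mx0 eqxx.
have dW' : (k * 2 <= \dim W')%N.
  have hW2 : (\dim (h @: W) <= 2)%N.
    by apply: leq_trans (dimvS (subvf _)) _; rewrite dimvf /dim /=.
  rewrite -(leq_add2r 2) addnC; apply: leq_trans dW _.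
  by rewrite -(limg_ker_dim h W) leq_add2l.
have ba : ev (b *m theta) a = -1 by rewrite anti ab1.
have [|f [fW fJ]] := IH W' dW'.
  move=> x /W'P[xW ax bx] x0; apply: ndW => // y yW.
  (* The symplectic projection of y on the orthogonal of a and b; its terms in
     a and b do not contribute to theta(x, y'). *)
  pose y' := y - ev (a *m theta) y *: b + ev (b *m theta) y *: a.
  have y'W : y' \in W'.
    apply/W'P; split; first by rewrite rpredD ?rpredB ?memvZ.
      by rewrite evDr evDr evNr !evZr ab1 alt mulr1 subrr mulr0 addr0.
    by rewrite evDr evDr evNr !evZr alt ba mulr0 oppr0 addr0 mulrN1 subrr.
  have := x0 y' y'W; rewrite !evDr evNr !evZr (anti x a) (anti x b) ax bx.
  by rewrite !oppr0 !mulr0 oppr0 !addr0.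
pose g (i : 'I_(2 + k * 2)) := match fintype.split i with
  | inl j => if j == 0 then a else b | inr j => f j end.
have gl0 : g (lshift _ 0) = a by rewrite /g (unsplitK (inl _)).
have gl1 : g (lshift _ 1) = b by rewrite /g (unsplitK (inl _)).
have gr j : g (rshift _ j) = f j by rewrite /g (unsplitK (inr _)).
have I2 (i : 'I_2) : i = 0 \/ i = 1.
  by case: i => -[|[|//]] hi; [left|right]; exact: val_inj.
have fP j : [/\ f j \in W, ev (a *m theta) (f j) = 0 & ev (b *m theta) (f j) = 0].
  exact/W'P.
exists g; split=> [i|i j].
  by case: (split_ordP i) => j ->; [case: (I2 j) => ->; rewrite ?gl0 ?gl1|
    rewrite gr; have [] := fP j].
case: (split_ordP i) => i' ->; case: (split_ordP j) => j' ->.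
- by case: (I2 i') => ->; case: (I2 j') => ->; rewrite ?gl0 ?gl1 ?alt ?ab1 ?ba /J.
- have [_ f1 f2] := fP j'.
  by case: (I2 i') => ->; rewrite ?gl0 ?gl1 gr ?f1 ?f2 /J /= ?add2n ?andbF.
- have [_ f1 f2] := fP i'.
  by case: (I2 j') => ->; rewrite ?gl0 ?gl1 gr anti ?f1 ?f2 oppr0 /J /= ?add2n /= ?andbF.
- by rewrite !gr fJ /J /= !add2n !eqSS /= !negbK.
Qed.
End WedgePower.

(** * A frame of E whose second section is a 1-form *)

Section AdaptedFrame.
Local Open Scope classical_set_scope.
Context {R : realType} {m : nat} {M : manifold R m}.
Local Notation TT := ('rV[R]_(m + m)).
Local Notation TTC := ('rV[R[i]]_(m + m)).

Lemma anchor_image_span (u v : TT) :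
  anchor_image <<[:: u; v]>>%VS = <<[:: lsubmx u; lsubmx v]>>%VS.
Proof. by rewrite /anchor_image limg_span /= !lfunE. Qed.

(** Write u = X + alpha and v = Y + beta. If X and Y were both nonzero they
   would be proportional, as the anchor image is a line. Isotropy gives
   alpha(X) = 0 and beta(Y) = 0, hence alpha(Y) = beta(X) = 0, contradicting
   the value of the pairing. They cannot both vanish, as covectors pair to
   zero. *)
Lemma isotropic_frame_anchor (u v : TT) :
  pairing u u = 0 -> pairing v v = 0 -> pairing u v = 2^-1 ->
  \dim (anchor_image <<[:: u; v]>>%VS) = 1%N ->
  (lsubmx u == 0) = (lsubmx v != 0).
Proof.
rewrite anchor_image_span -[u]hsubmxK -[v]hsubmxK !row_mxKl !pairing_row.
move: (lsubmx u) (rsubmx u) (lsubmx v) (rsubmx v) => X alpha Y beta.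
have inv2 : (2^-1 : R) != 0 by rewrite invr_eq0 two_neq0.
move=> /eqP; rewrite mulf_eq0 (negbTE inv2) /= -mulr2n mulrn_eq0 /= => /eqP aX.
move=> /eqP; rewrite mulf_eq0 (negbTE inv2) /= -mulr2n mulrn_eq0 /= => /eqP bY.
rewrite -{2}[2^-1]mulr1 => /(mulfI inv2) aYbX dim1.
have [X0|X0] := eqVneq X 0; have [Y0|Y0] := eqVneq Y 0 => //.
  by move/eqP: aYbX; rewrite X0 Y0 !ev0r addr0 eq_sym oner_eq0.
have XE : <[X]>%VS = <<[:: X; Y]>>%VS.
  apply/eqP; rewrite eqEdim dim1 dim_vline X0 andbT.
  by apply/subvP => _ /vlineP[c ->]; rewrite memvZ// memv_span// inE eqxx.
have /vlineP[c Yc] : Y \in <[X]>%VS by rewrite XE memv_span// !inE eqxx orbT.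
have c0 : c != 0 by apply: contraNneq Y0 => c0; rewrite Yc c0 scale0r.
move/eqP: bY; rewrite Yc evZr mulf_eq0 (negbTE c0) /= => /eqP bX.
by move/eqP: aYbX; rewrite Yc evZr aX bX mulr0 addr0 eq_sym oner_eq0.
Qed.

(** The components of e refer to a different frame at each point, so
   continuity is used in one chart, where the anchor is multiplied by an
   invertible Jacobian. *)
Lemma anchor_neq0_near (e : M -> TT) x0 : smooth_section setT e ->
  lsubmx (e x0) != 0 -> \forall x \near x0, lsubmx (e x) != 0.
Proof.
move=> se e0; pose c := chart_at x0.
have ac : atlas c := chart_at_atlas x0.
have dx : dom c x0 := chart_at_dom x0.
have JE x : lsubmx (e x *m bigtangent_coord c x) = lsubmx (e x) *m tangent_coord c x.
  by rewrite -{1}[e x]hsubmxK bigtangent_row row_mxKl.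
pose f p := lsubmx (e (param c p) *m bigtangent_coord c (param c p)).
have cf : {for coord c x0, continuous f}.
  by apply: (smooth_charts_lsubmx (@openT M) se ac 0%N); exists x0.
have f0 : f (coord c x0) != 0.
  rewrite /f coordK// JE; apply: contra_neq e0 => /(congr1 (mulmx^~ (invmx (tangent_coord c x0)))).
  by rewrite mulmxK ?mul0mx//; exact: tangent_coord_unit.
have nP : \forall p \near coord c x0, f p != 0.
  move: cf f0; move: (coord c x0) => p cf f0; exact: (cvgr_neq0 _ cf f0).
have h : \forall x \near x0, f (coord c x) != 0 := coord_continuous dx nP.
have d : nbhs (x0 : M) (dom c) by apply: open_nbhs_nbhs; split=> //; exact: dom_open.
apply: filterS2 h d => x /= ex dcx; move: ex; rewrite /f coordK// JE.
by apply: contra_neq => ->; rewrite mul0mx.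
Qed.

(** Exactly one of the two sections has zero anchor at each point. The two
   corresponding sets are open, so exchanging the sections on one of them
   keeps the frame smooth; M need not be connected. *)
Lemma contact_frame (E : M -> {vspace TT}) (L : M -> {vspace TTC}) :
  gen_almost_contact E L -> (forall x, type_p E x = 1%N) ->
  exists f1 f2 : M -> TT, [/\ smooth_section setT f1, smooth_section setT f2,
    isotropic_pair f1 f2, (forall x, E x = <<[:: f1 x; f2 x]>>%VS) &
    forall x, lsubmx (f2 x) = 0].
Proof.
move=> [[e1 [e2 [s1 s2 ie EE]]] _ _ _] p1.
have anti x : (lsubmx (e1 x) == 0) = (lsubmx (e2 x) != 0).
  have [e11 e22 e12] := ie x; apply: isotropic_frame_anchor => //.
  by rewrite -EE; exact: p1.
pose swapped x := lsubmx (e2 x) != 0.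
have local x0 : exists2 U : set M, open U /\ U x0 &
    (forall x, U x -> swapped x = swapped x0).
  have [e20|e20] := eqVneq (lsubmx (e2 x0)) 0.
    have e10 : lsubmx (e1 x0) != 0 by rewrite anti e20 eqxx.
    exists ([set x | lsubmx (e1 x) != 0]°); first split.
    - exact: open_interior.
    - exact: anchor_neq0_near s1 e10.
    - by move=> x /interior_subset /=; rewrite /swapped e20 eqxx anti negbK => /eqP ->; rewrite eqxx.
  exists ([set x | lsubmx (e2 x) != 0]°); first split.
  - exact: open_interior.
  - exact: anchor_neq0_near s2 e20.
  - by move=> x /interior_subset /=; rewrite /swapped e20.
pose f1 x := if swapped x then e2 x else e1 x.
pose f2 x := if swapped x then e1 x else e2 x.
have smooth_glue (g h : M -> TT) : smooth_section setT g -> smooth_section setT h ->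
    smooth_section setT (fun x => if swapped x then g x else h x).
  move=> sg sh; apply: smooth_charts_local => x0; have [U [oU Ux] UE] := local x0.
  exists U => //.
  have sE : smooth_section U (if swapped x0 then g else h).
    by case: (swapped x0); [apply: smooth_charts_subset sg|apply: smooth_charts_subset sh].
  apply: smooth_charts_congr sE => // c x _ Ux' _; rewrite UE//.
  by case: (swapped x0).
exists f1, f2; split.
- exact: smooth_glue.
- exact: smooth_glue.
- move=> x; have [e11 e22 e12] := ie x; rewrite /f1 /f2.
  by case: (swapped x); split=> //; rewrite pairingC.
- move=> x; rewrite EE /f1 /f2; case: (swapped x) => //.
  by rewrite !span_cons span_nil !addv0 addvC.
- move=> x; rewrite /f2 /swapped; case: eqP => //= /eqP.
  by rewrite -anti => /eqP.
Qed.

End AdaptedFrame.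

(** * B-field transformations *)

Section BField.
Local Open Scope classical_set_scope.
Context {R : realType} {m : nat} {M : manifold R m}.
Local Notation TT := ('rV[R]_(m + m)).
Local Notation TTC := ('rV[R[i]]_(m + m)).

(** The B-field transformation X + alpha |-> X + alpha + i_X B. *)
Definition bfield (B : 'M[R]_m) : 'M[R]_(m + m) := block_mx 1%:M B 0 1%:M.

Lemma row_bfield (X alpha : 'rV[R]_m) B :
  row_mx X alpha *m bfield B = row_mx X (X *m B + alpha).
Proof. by rewrite mul_row_block !mulmx1 mulmx0 addr0. Qed.

Lemma bfield_isometry B : B^T = - B ->
  forall u v : TT, pairing (u *m bfield B) (v *m bfield B) = pairing u v.
Proof.
move=> BT; apply/(isometryP (two_neq0 (R := R)) _).2.
rewrite /bfield /swapmx tr_block_mx trmx0 !trmx1 !mulmx_block BT.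
by rewrite !(mulmx0, mul0mx, mulmx1, mul1mx, addr0, add0r) subrr.
Qed.

Lemma inv_bfield B : invmx (bfield B) = bfield (- B).
Proof.
have h : bfield B *m bfield (- B) = 1%:M.
  rewrite /bfield mulmx_block.
  by rewrite !(mulmx0, mul0mx, mulmx1, mul1mx, addr0, add0r) addNr -scalar_mx_block.
have [u _] := mulmx1_unit h.
by rewrite -[RHS](mulKmx u) h mulmx1.
Qed.

Lemma bfield_morphism (B : M -> 'M[R]_m) :
  smooth_two_form B -> bundle_morphism (fun x => bfield (B x)).
Proof.
have oT : open [set: M] by exact: openT.
move=> [_ sB]; apply: morphism_block => //.
- apply: smooth_charts_congr (smooth_charts_cst setT 1%:M) => // c x ac _ dx.
  by rewrite /= mulmx1 mulVmx//; exact: tangent_coord_unit.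
- apply: smooth_charts_congr (smooth_charts_cst setT 0) => // c x _ _ _.
  by rewrite /= mulmx0 mul0mx.
- apply: smooth_charts_congr (smooth_charts_cst setT 1%:M) => // c x ac _ dx.
  by rewrite /= mulmx1 -trmx_mul mulVmx ?trmx1//; exact: tangent_coord_unit.
Qed.

Lemma anchor_image_bfield (L : {vspace TTC}) B :
  anchor_image (mx_image (cmx (bfield B)) L) = anchor_image L.
Proof.
rewrite /anchor_image /mx_image -limg_comp; congr lfun_img; apply/lfunP => u.
rewrite comp_lfunE !lfunE /= -[u]hsubmxK /cmx map_block_mx mul_row_block.
by rewrite map_mx0 !map_mx1 mulmx0 mulmx1 addr0 !row_mxKl.
Qed.

Lemma smooth_wedge_form (a b : M -> 'rV[R]_m) :
  smooth_one_form a -> smooth_one_form b ->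
  smooth_two_form (fun x => (a x)^T *m b x - (b x)^T *m a x).
Proof.
have oT : open [set: M] by exact: openT.
move=> sa sb; split=> [x|].
  by rewrite linearB /= !trmx_mul !trmxK opprB.
have sab := smooth_charts_mulmx oT (smooth_charts_trmx oT sa) sb.
have sba := smooth_charts_mulmx oT (smooth_charts_trmx oT sb) sa.
apply: smooth_charts_congr (smooth_charts_addmx oT sab (smooth_charts_scale oT (-1) sba)) => // c x _ _ _.
by rewrite /= scaleN1r mulmxBr mulmxBl !trmx_mul !trmxK !mulmxA.
Qed.

(** A B-field leaves the tangent part unchanged, so it preserves the anchor
   image of L and the type t_L. *)
Lemma bfield_transform E L (B : M -> 'M[R]_m) Phi e1 e2 :
  smooth_two_form B -> gen_almost_contact E L -> represents Phi e1 e2 E L ->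
  exists E' L', [/\ gen_almost_contact E' L', isomorphic E L E' L',
    represents (fun x => bfield (- B x) *m Phi x *m bfield (B x))
      (fun x => e1 x *m bfield (B x)) (fun x => e2 x *m bfield (B x)) E' L' &
    forall x, type_t L' x = type_t L x].
Proof.
move=> sB hEL hP; have sF := bfield_morphism sB.
have isoF x := bfield_isometry (sB.1 x).
exists (fun x => mx_image (bfield (B x)) (E x)), (fun x => mx_image (cmx (bfield (B x))) (L x)).
split.
- exact: (transport_gac sF isoF).
- exact: transport_isomorphic.
- have := transport_represents sF isoF hP.
  by under [fun x => invmx _ *m _ *m _]eq_fun do rewrite inv_bfield.
- by move=> x; rewrite /type_t anchor_image_bfield.
Qed.

(** With e_2 = eta and e_1 = xi + alpha one has eta(xi) = 1 and alpha(xi) = 0.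
   The B-field of the 2-form sending X to alpha(X) eta - eta(X) alpha sends xi
   to xi + alpha - alpha = xi and fixes eta. *)
Lemma poon_wade_form E L :
  gen_almost_contact E L -> (forall x, type_p E x = 1%N) ->
  exists E' L' Phi (xi eta : M -> 'rV[R]_m),
    [/\ gen_almost_contact E' L', isomorphic E L E' L',
    represents Phi (fun x => row_mx (xi x) 0) (fun x => row_mx 0 (eta x)) E' L' &
    forall x, type_t L' x = type_t L x].
Proof.
move=> hEL p1; have [f1 [f2 [s1 s2 ie EE f20]]] := contact_frame hEL p1.
have [Phi hP] := contact_endomorphism hEL s1 s2 ie EE.
pose xi x := lsubmx (f1 x); pose alpha x := rsubmx (f1 x).
pose eta x := rsubmx (f2 x).
have f1E x : f1 x = row_mx (xi x) (alpha x) by rewrite hsubmxK.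
have f2E x : f2 x = row_mx 0 (eta x) by rewrite -[f2 x]hsubmxK f20.
have oT : open [set: M] by exact: openT.
have s1' : smooth_section setT (fun x => row_mx (xi x) (alpha x)).
  by apply: (smooth_charts_congr oT _ s1) => c x _ _ _; rewrite f1E.
have s2' : smooth_section setT (fun x => row_mx 0 (eta x)).
  by apply: (smooth_charts_congr oT _ s2) => c x _ _ _; rewrite f2E.
have [_ sa] := (section_row xi alpha).1 s1'.
have [_ se] := (section_row (fun=> 0) eta).1 s2'.
have [ax ex] : (forall x, ev (alpha x) (xi x) = 0) /\ (forall x, ev (eta x) (xi x) = 1).
  have two0 := two_neq0 (R := R).
  split=> x; have [h1 _ h2] := ie x.
    move/eqP: h1; rewrite f1E pairing_row mulf_eq0 invr_eq0 (negbTE two0) /=.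
    by rewrite -mulr2n mulrn_eq0 => /eqP.
  move: h2; rewrite f1E f2E pairing_row ev0r add0r -{2}[2^-1]mulr1.
  by apply: mulfI; rewrite invr_eq0.
have sB := smooth_wedge_form sa se.
have [E' [L' [hE' hI hR ht]]] := bfield_transform sB hEL hP.
have e1E : (fun x => f1 x *m bfield ((alpha x)^T *m eta x - (eta x)^T *m alpha x)) =
    (fun x => row_mx (xi x) 0).
  apply/funext => x; rewrite f1E row_bfield mulmxBr !mul_rank1 ax ex.
  by rewrite scale0r scale1r add0r addNr.
have e2E : (fun x => f2 x *m bfield ((alpha x)^T *m eta x - (eta x)^T *m alpha x)) =
    (fun x => row_mx 0 (eta x)).
  by apply/funext => x; rewrite f2E row_bfield mul0mx add0r.
rewrite e1E e2E in hR.
by exists E', L'; eexists; exists xi, eta; split; [exact: hE'|exact: hI|exact: hR|].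
Qed.

End BField.

(** * The blocks of the endomorphism of a Poon-Wade triple *)

Section PoonWadeBlocks.
Context {R : realType} {m : nat}.
Local Notation TT := ('rV[R]_(m + m)).

(** The endomorphism in terms of TM and T*M: A is an endomorphism of TM, s a
   2-form, p a bivector. The equations are skewness, the vanishing on xi and
   eta, and the four blocks of the formula for the square. *)
Definition contact_blocks (Phi : 'M[R]_(m + m)) (xi eta : 'rV[R]_m)
    (A s p : 'M[R]_m) : Prop :=
  [/\ Phi = block_mx A s p (- A^T), s^T = - s /\ p^T = - p,
      [/\ ev eta xi = 1, xi *m A = 0, xi *m s = 0, eta *m p = 0 & eta *m A^T = 0],
      A *m A + s *m p = - 1%:M + eta^T *m xi /\ p *m s + A^T *m A^T = - 1%:M + xi^T *m eta &
      A *m s = s *m A^T /\ p *m A = A^T *m p].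

Lemma poon_wade_blocks (Phi : 'M[R]_(m + m)) (xi eta : 'rV[R]_m) :
  let e1 := row_mx xi 0 in let e2 := row_mx 0 eta in
  pairing e1 e2 = 2^-1 ->
  (forall u v : TT, pairing (u *m Phi) v = pairing u (- (v *m Phi))) ->
  e1 *m Phi = 0 -> e2 *m Phi = 0 ->
  (forall u : TT, u *m Phi *m Phi =
         - u + (2 * pairing u e1) *: e2 + (2 * pairing u e2) *: e1) ->
  contact_blocks Phi xi eta (ulsubmx Phi) (ursubmx Phi) (dlsubmx Phi).
Proof.
move=> e1 e2 e12 sk P1 P2 PP; have two0 := two_neq0 (R := R).
have inv2 : (2^-1 : R) != 0 by rewrite invr_eq0.
have ex : ev eta xi = 1.
  move: e12; rewrite /e1 /e2 pairing_row ev0l add0r -{2}[2^-1]mulr1.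
  exact: mulfI.
rewrite -[Phi]submxK in sk P1 P2 PP *.
rewrite block_mxKul block_mxKur block_mxKdl.
move: (ulsubmx Phi) (ursubmx Phi) (dlsubmx Phi) (drsubmx Phi) sk P1 P2 PP => A s p D sk P1 P2 PP.
have formP q (N : 'M[R]_q) : (forall u v : 'rV_q, u *m N *m v^T = 0) -> N = 0.
  move=> h; apply/matrixP => i j; have /matrixP/(_ 0 0) := h (delta_mx 0 i) (delta_mx 0 j).
  by rewrite -rowE trmx_delta -colE !mxE.
have actP q (N N' : 'M[R]_q) : (forall u : 'rV_q, u *m N = u *m N') -> N = N'.
  by move=> h; apply/row_matrixP => i; rewrite !rowE h.
have : block_mx A s p D *m swapmx + swapmx *m (block_mx A s p D)^T = 0.
  apply: formP => u v; rewrite mulmxDr mulmxDl.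
  have -> : u *m (swapmx *m (block_mx A s p D)^T) *m v^T =
      u *m swapmx *m (v *m block_mx A s p D)^T by rewrite trmx_mul !mulmxA.
  rewrite mulmxA !swap_pairing sk pairingNr -raddfD /= -mulrDr addNr mulr0.
  exact: raddf0.
rewrite tr_block_mx /swapmx !mulmx_block !(mulmx0, mul0mx, mulmx1, mul1mx, addr0, add0r).
rewrite add_block_mx -[0]block_mx0 => /eq_block_mx[/eqP ss /eqP AD _ /eqP pp].
have sT : s^T = - s by apply/eqP; rewrite -addr_eq0 addrC.
have pT : p^T = - p by apply/eqP; rewrite -addr_eq0 addrC.
have DE : D = - A^T by rewrite -[LHS]trmxK; move: AD; rewrite addr_eq0 => /eqP ->;
  rewrite linearN /= opprK.
subst D.
have : block_mx A s p (- A^T) *m block_mx A s p (- A^T) =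
    - 1%:M + block_mx (eta^T *m xi) 0 0 (xi^T *m eta).
  apply: actP => u; rewrite mulmxA PP mulmxDr mulmxN mulmx1 -addrA; congr (_ + _).
  rewrite -{1 2 3}[u]hsubmxK /e1 /e2 !pairing_row !mul_row_block !mulmx0 ev0l ev0r.
  rewrite addr0 !add0r !mulrA divff// !mul1r !mul_rank1 !scale_row_mx !scaler0.
  by rewrite addr0 add_row_mx add0r addr0 (evC xi).
rewrite mulmx_block (scalar_mx_block m m) opp_block_mx add_block_mx !oppr0 !add0r.
move=> /eq_block_mx[AA As pA pp2].
split=> //.
- move: P1 P2; rewrite /e1 /e2 !mul_row_block !mul0mx !addr0 !add0r -[0]row_mx0.
  move=> /eq_row_mx[xA xs] /eq_row_mx[ep]; rewrite mulmxN => /eqP; rewrite oppr_eq0 => /eqP eA.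
  by split.
- by split=> //; rewrite -pp2 mulmxN mulNmx opprK.
- split; apply/eqP; first by rewrite -subr_eq0 -mulmxN As.
  by rewrite -subr_eq0 -mulNmx pA.
Qed.

End PoonWadeBlocks.

(** * What the type of L says about the bivector block *)

Section PointwiseTypes.
Context {R : realType} {m : nat}.
Local Notation TT := ('rV[R]_(m + m)).
Local Notation TTC := ('rV[R[i]]_(m + m)).
Local Notation re := (map_mx (@complex.Re R)).
Local Notation im := (map_mx (@complex.Im R)).
Context (Phi : 'M[R]_(m + m)) (xi eta : 'rV[R]_m) (A s p : 'M[R]_m).
Context (L : {vspace TTC}).
Hypothesis blocks : contact_blocks Phi xi eta A s p.
Hypothesis eigen : forall u : TTC, u \in L <-> u *m cmx Phi = 'i%C *: u.

Let cotangent : {vspace TTC} :=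
  (L :&: lker (linfun (fun u : TTC => lsubmx u)))%VS.

Let mem_cotangent u : (u \in cotangent) = (u \in L) && (lsubmx u == 0).
Proof. by rewrite memv_cap memv_ker lfunE. Qed.

Lemma anchor_dim : (\dim cotangent + \dim (anchor_image L))%N = \dim L.
Proof. exact: limg_ker_dim. Qed.

(** If [beta *m p] = 0 with beta(xi) = 0, the image of beta is again a
   covector, and beta minus i times its image is an eigenvector for i without
   tangent part. So p is injective on Ann xi, and the term [xi^T *m xi] takes
   care of eta. *)
Lemma bivector_unit : \dim cotangent = 0%N -> p + xi^T *m xi \in unitmx.
Proof.
move=> /eqP; rewrite dimv_eq0 => /eqP cot0.
have [PE [sT pT] [ex xA xs ep eA] [AA pp] [As pA]] := blocks.
rewrite -row_free_unit -kermx_eq0; apply/eqP/row_matrixP => i; rewrite row0.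
have : row i (kermx (p + xi^T *m xi)) *m (p + xi^T *m xi) = 0 by rewrite -row_mul mulmx_ker row0.
move: (row i _) => beta b0.
have pe : p *m eta^T = 0 by rewrite -[p]trmxK pT -trmx_mul mulmxN ep oppr0 trmx0.
have bx : ev xi beta = 0.
  have := congr1 (mulmx^~ eta^T) b0; rewrite /= mul0mx -mulmxA mulmxDl pe add0r.
  rewrite -mulmxA (mul_tr_ev eta) ex mulmx1 (mul_tr_ev xi) => /matrixP/(_ 0 0).
  by rewrite !mxE.
have bp : beta *m p = 0 by move: b0; rewrite mulmxDr mul_rank1 bx scale0r addr0.
pose v : TT := row_mx 0 beta.
have vP : v *m Phi = row_mx 0 (- (beta *m A^T)).
  by rewrite /v PE mul_row_block !mul0mx !add0r bp mulmxN.
have vPP : v *m Phi *m Phi = - v.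
  rewrite vP PE mul_row_block !mul0mx !add0r mulNmx -mulmxA -pA mulmxA bp mul0mx oppr0.
  rewrite mulmxN mulNmx opprK -mulmxA.
  have -> : A^T *m A^T = - 1%:M + xi^T *m eta - p *m s by rewrite -pp addrAC subrr add0r.
  rewrite mulmxBr mulmxDr mul_rank1 bx scale0r addr0 mulmxA bp mul0mx subr0.
  by rewrite mulmxN mulmx1 /v opp_row_mx oppr0.
have : cpx v (- (v *m Phi)) \in cotangent.
  rewrite mem_cotangent; apply/andP; split.
    by apply/eigen; rewrite /cmx mul_cpx_rc mulNmx vPP !cpxZi !opprK.
  by rewrite vP /v opp_row_mx oppr0 cpx_row_mx row_mxKl cpx00.
rewrite cot0 memv0 => /eqP; rewrite -cpx00 => /cpx_inj[v0 _].
by have := congr1 rsubmx v0; rewrite row_mxKr linear0.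
Qed.

(** The cotangent part of L is spanned by the rows of a + i b. The covectors
   given by the rows of a and b and by eta are independent, since the
   endomorphism acts on them with eigenvalues i, - i and 0; by the hypothesis
   on the dimension they span all covectors. As their images are covectors, p
   vanishes. *)
Lemma bivector_zero : (\dim cotangent + \dim cotangent).+1 = m -> p = 0.
Proof.
set k := \dim cotangent => km.
have [PE [sT pT] [ex xA xs ep eA] [AA pp] [As pA]] := blocks.
pose t (i : 'I_k) := (vbasis cotangent)`_i.
have bt : basis_of cotangent [seq t i | i <- enum 'I_k].
  rewrite (_ : [seq _ | i <- _] = vbasis cotangent) ?vbasisP//.
  suff -> : vbasis cotangent = [tuple t i | i < k] by [].
  by apply: eq_from_tnth => i; rewrite tnth_mktuple (tnth_nth 0).
have [_ t_free memt] := basis_matrix bt.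
pose a : 'M[R]_(k, m + m) := \matrix_i re (t i).
pose b : 'M[R]_(k, m + m) := \matrix_i im (t i).
have SE : \matrix_i t i = cpx a b.
  by rewrite [LHS]cpxE; congr cpx; apply/matrixP => i j; rewrite !mxE.
have tc i : t i \in cotangent.
  by apply/memt; exists (delta_mx 0 i); rewrite -rowE rowK.
have [aP bP] : a *m Phi = - b /\ b *m Phi = a.
  apply: cpx_inj; rewrite -mul_cpx_rc -cpxZi -SE.
  apply/row_matrixP => i; rewrite row_mul rowK linearZ /= rowK.
  by apply/eigen; have := tc i; rewrite mem_cotangent => /andP[].
pose e2 : TT := row_mx 0 eta.
have e2P : e2 *m Phi = 0.
  by rewrite /e2 PE mul_row_block !mul0mx !add0r ep mulmxN eA oppr0 row_mx0.
pose Q : 'M[R]_(k + k + 1, m + m) := col_mx (col_mx a b) e2.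
pose rot : 'M[R]_(k + k + 1) := block_mx (block_mx 0 (- 1%:M) 1%:M 0) 0 0 0.
have QP : Q *m Phi = rot *m Q.
  have -> : rot *m Q = col_mx (col_mx (- b) a) 0.
    by rewrite /rot /Q !mul_block_col !mul0mx !addr0 add0r mulNmx !mul1mx.
  by rewrite /Q !mul_col_mx aP bP e2P.
have Ql : lsubmx Q = 0.
  have tl i : lsubmx (t i) = 0 by have := tc i; rewrite mem_cotangent => /andP[_ /eqP].
  apply/matrixP => i j; rewrite [RHS]mxE mxE.
  have tij i' : t i' 0 (lshift m j) = 0.
    by have /matrixP/(_ 0 j) := tl i'; rewrite !mxE.
  case: (split_ordP i) => i' ->; last by rewrite col_mxEd row_mxEl mxE.
  rewrite col_mxEu; case: (split_ordP i') => l ->.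
    by rewrite col_mxEu !mxE tij.
  by rewrite col_mxEd !mxE tij.
have [Q2 QE] : exists Q2, Q = row_mx 0 Q2.
  by exists (rsubmx Q); rewrite -{1}[Q]hsubmxK Ql.
have Q_free (w : 'rV_(k + k + 1)) : w *m Q = 0 -> w = 0.
  rewrite -[w]hsubmxK -[lsubmx w]hsubmxK.
  move: (lsubmx (lsubmx w)) (rsubmx (lsubmx w)) (rsubmx w) => x y z.
  rewrite /Q !mul_row_col => h0.
  have h1 : y *m a - x *m b = 0.
    have := congr1 (mulmx^~ Phi) h0; rewrite /= mul0mx !mulmxDl -!mulmxA aP bP e2P.
    by rewrite mulmx0 addr0 mulmxN addrC.
  have h2 : x *m a + y *m b = 0.
    have := congr1 (mulmx^~ Phi) h1; rewrite /= mul0mx mulmxBl -!mulmxA aP bP.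
    by rewrite mulmxN => /eqP; rewrite -opprD oppr_eq0 addrC => /eqP.
  have : cpx x (- y) *m \matrix_i t i = 0.
    rewrite SE cpxM !mulNmx opprK h2 -cpx00; congr cpx.
    by rewrite -[LHS]opprK opprB h1 oppr0.
  move=> /t_free; rewrite -cpx00 => /cpx_inj[x0 /eqP]; rewrite oppr_eq0 => /eqP y0.
  move: h0; rewrite x0 y0 !mul0mx !add0r [z]mx11_scalar mul_scalar_mx => z0.
  suff -> : z 0 0 = 0 by rewrite raddf0 !row_mx0.
  have := congr1 (fun u => ev (rsubmx u) xi) z0.
  by rewrite /= linearZ /= row_mxKr evZl ex mulr1 linear0 ev0l.
have Q2_free : row_free Q2.
  rewrite -kermx_eq0; apply/eqP/row_matrixP => i; rewrite row0; apply: Q_free.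
  by rewrite QE mul_mx_row mulmx0 -row_mul mulmx_ker row0 row_mx0.
have /row_fullP[Q' Q'Q] : row_full Q2.
  by rewrite /row_full (eqP Q2_free) addn1 km.
have : lsubmx (Q *m Phi) = 0 by rewrite QP QE mul_mx_row mulmx0 row_mxKl.
rewrite QE PE mul_row_block !mul0mx !add0r row_mxKl => h.
by rewrite -[p]mul1mx -Q'Q -mulmxA h mulmx0.
Qed.

End PointwiseTypes.

Section EigenbundleBlocks.
Local Open Scope classical_set_scope.
Context {R : realType} {m : nat} {M : manifold R m}.
Local Notation TT := ('rV[R]_(m + m)).
Local Notation TTC := ('rV[R[i]]_(m + m)).
Context (E : M -> {vspace TT}) (L : M -> {vspace TTC}).
Context (Phi : M -> 'M[R]_(m + m)) (xi eta : M -> 'rV[R]_m).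

Hypothesis hP : represents Phi (fun x => row_mx (xi x) 0) (fun x => row_mx 0 (eta x)) E L.

Local Notation A x := (ulsubmx (Phi x)).
Local Notation s x := (ursubmx (Phi x)).
Local Notation p x := (dlsubmx (Phi x)).

Lemma represents_blocks x : contact_blocks (Phi x) (xi x) (eta x) (A x) (s x) (p x).
Proof.
have [[_ _ _ ie hx] _] := hP; have [e11 e22 e12] := ie x.
by have [sk P1 P2 PP] := hx x; exact: poon_wade_blocks.
Qed.

Lemma represents_smooth :
  [/\ smooth_vector_field xi, smooth_one_form eta, smooth_tangent_endo (fun x => A x),
   smooth_in_charts setT (fun c x =>
     invmx (tangent_coord c x) *m s x *m (invmx (tangent_coord c x))^T) &
   smooth_in_charts setT (fun c x =>
     (tangent_coord c x)^T *m p x *m tangent_coord c x)].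
Proof.
have [[sP s1 s2 _ _] _] := hP; have oT : open [set: M] by exact: openT.
have [sx _] := (section_row xi (fun=> 0)).1 s1.
have [_ se] := (section_row (fun=> 0) eta).1 s2.
have sB : bundle_morphism (fun x => block_mx (A x) (s x) (p x) (drsubmx (Phi x))).
  by apply: (smooth_charts_congr oT _ sP) => c x _ _ _; rewrite /= submxK.
by have [sA ss sp] := block_morphism sB; split.
Qed.

End EigenbundleBlocks.

(** * Normal forms for the two extreme types *)

Section TransverseBField.
Local Open Scope classical_set_scope.
Context {R : realType} {m : nat} {M : manifold R m}.
Local Notation TT := ('rV[R]_(m + m)).
Local Notation TTC := ('rV[R[i]]_(m + m)).
Context (E : M -> {vspace TT}) (L : M -> {vspace TTC}).
Context (Phi : M -> 'M[R]_(m + m)) (xi eta : M -> 'rV[R]_m).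

Hypothesis hEL : gen_almost_contact E L.
Hypothesis hP : represents Phi (fun x => row_mx (xi x) 0) (fun x => row_mx 0 (eta x)) E L.

Let A x := ulsubmx (Phi x).
Let s x := ursubmx (Phi x).
Let p x := dlsubmx (Phi x).
Let blocks x : contact_blocks (Phi x) (xi x) (eta x) (A x) (s x) (p x) :=
  represents_blocks hP x.

Let cotangent x : {vspace TTC} :=
  (L x :&: lker (linfun (fun u : TTC => lsubmx u)))%VS.

(** A B-field with i_xi B = 0 fixes both sections of a Poon-Wade triple. *)
Lemma bfield_transform_transverse (B : M -> 'M[R]_m) :
  smooth_two_form B -> (forall x, xi x *m B x = 0) ->
  exists E' L', [/\ gen_almost_contact E' L', isomorphic E L E' L' &
    represents (fun x => bfield (- B x) *m Phi x *m bfield (B x))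
      (fun x => row_mx (xi x) 0) (fun x => row_mx 0 (eta x)) E' L'].
Proof.
move=> sB xB; have [E' [L' [hE' hI hR _]]] := bfield_transform sB hEL hP.
exists E', L'; split=> //; move: hR.
have -> : (fun x => row_mx (xi x) 0 *m bfield (B x)) = (fun x => row_mx (xi x) 0).
  by apply/funext => x; rewrite row_bfield xB addr0.
suff -> : (fun x => row_mx 0 (eta x) *m bfield (B x)) = (fun x => row_mx 0 (eta x)) by [].
by apply/funext => x; rewrite row_bfield mul0mx add0r.
Qed.

Lemma bfield_conj (B A' s' p' D' : 'M[R]_m) :
  bfield (- B) *m block_mx A' s' p' D' *m bfield B =
  block_mx (A' - B *m p') ((A' - B *m p') *m B + (s' - B *m D')) p' (p' *m B + D').
Proof.
rewrite /bfield !mulmx_block !(mulmx0, mul0mx, mulmx1, mul1mx, addr0, add0r).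
by rewrite !mulNmx.
Qed.

(** The type t_L, the dimension of the cotangent part of L and the dimension
   of L determine each other. *)
Lemma type_dims x : (\dim (anchor_image (L x)) = m - type_t L x)%N /\
  (\dim (cotangent x) + \dim (anchor_image (L x)))%N = \dim (L x) /\
  (\dim (L x) + \dim (L x) + 2 = m + m)%N.
Proof.
split; last by split; [exact: anchor_dim|exact: contact_dim hEL].
rewrite /type_t subKn//; apply: leq_trans (dimvS (subvf _)) _.
by rewrite dimvf /dim /= mul1n.
Qed.

(** The bivector p is invertible from Ann xi to Ker eta, so there is a unique
   B with i_xi B = 0 and B p = A; it is antisymmetric because p A is. The
   B-field transformation replaces A by A - B p = 0. What remains is the
   bivector p and a 2-form theta with theta p = - 1 on Ker eta, which is the
   Poon-Wade triple of (theta, eta). *)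
Lemma almost_cosymplectic_form n : m = (2 * n).+1 -> (forall x, type_t L x = 1%N) ->
  exists E' L', [/\ gen_almost_contact E' L', isomorphic E L E' L' &
    exists theta eta Phi e1 e2,
      [/\ almost_cosymplectic n theta eta,
          triple_of_almost_cosymplectic theta eta Phi e1 e2 &
          represents Phi e1 e2 E' L']].
Proof.
move=> mE t1; have oT : open [set: M] by exact: openT.
(* It agrees with p on Ann xi and sends eta to xi, which makes it invertible. *)
pose pit x := p x + (xi x)^T *m xi x.
have pit_unit x : pit x \in unitmx.
  apply: bivector_unit (blocks x) _ _; first by move=> u; exact: (hP.2 x).2.
  have [h1 [h2 h3]] := type_dims x; rewrite t1 in h1.
  by move: h2; rewrite -/(cotangent x); lia.
have [sx se sA ss sp] := represents_smooth hP.
pose B x := A x *m invmx (pit x).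
have xB x : xi x *m B x = 0.
  by have [_ _ [_ xA _ _ _] _ _] := blocks x; rewrite /B mulmxA xA mul0mx.
have pe x : p x *m (eta x)^T = 0.
  have [_ [_ pT] [_ _ _ ep _] _ _] := blocks x.
  by rewrite -[p x]trmxK pT -trmx_mul mulmxN ep oppr0 trmx0.
have Bx x : B x *m (xi x)^T = 0.
  have [_ _ [ex _ _ _ eA] _ _] := blocks x.
  have <- : pit x *m (eta x)^T = (xi x)^T.
    by rewrite mulmxDl pe add0r -mulmxA mul_tr_ev ex mulmx1.
  by rewrite /B mulmxA mulmxKV// -[A x]trmxK -trmx_mul eA trmx0.
have Bp x : B x *m p x = A x.
  have : B x *m pit x = A x by rewrite /B mulmxKV.
  by rewrite mulmxDr mulmxA Bx mul0mx addr0.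
have BT x : (B x)^T = - B x.
  have [_ [_ pT] [_ xA _ _ _] _ [_ pA]] := blocks x.
  (* Antisymmetry is invariant under the congruence by pit. *)
  have h : pit x *m (B x + (B x)^T) *m (pit x)^T = 0.
    rewrite mulmxDr mulmxDl.
    have -> : pit x *m (B x)^T *m (pit x)^T = (pit x *m B x *m (pit x)^T)^T.
      by rewrite !trmx_mul trmxK mulmxA.
    have -> : pit x *m B x *m (pit x)^T = - (p x *m A x).
      rewrite -mulmxA /pit [(_ + _)^T]linearD /= trmx_mul trmxK pT mulmxDr mulmxN Bp.
      by rewrite mulmxA Bx mul0mx addr0 mulmxN mulmxDl -mulmxA xA mulmx0 addr0.
    by rewrite linearN /= trmx_mul pT mulmxN -pA opprK addNr.
  apply/eqP; rewrite -addr_eq0 addrC; apply/eqP.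
  have uT : (pit x)^T \in unitmx by rewrite unitmx_tr.
  rewrite -[LHS](mulKmx (pit_unit x)) -[X in invmx _ *m X](mulmxK uT).
  by rewrite h mul0mx mulmx0.
have sB : smooth_two_form B.
  split=> //.
  have spit : smooth_in_charts setT (fun c x => let J := tangent_coord c x in
      J^T *m pit x *m J).
    have sxx := smooth_charts_mulmx oT (smooth_charts_trmx oT sx) sx.
    apply: (smooth_charts_congr oT _ (smooth_charts_addmx oT sp sxx)) => c x _ _ _ /=.
    by rewrite /pit mulmxDr mulmxDl trmx_mul !mulmxA.
  have uJ c x (ac : atlas c) (dx : dom c x) := tangent_coord_unit ac dx.
  have upit c x : atlas c -> setT x -> dom c x ->
      (tangent_coord c x)^T *m pit x *m tangent_coord c x \in unitmx.
    by move=> ac _ dx; rewrite !unitmx_mul unitmx_tr !uJ ?pit_unit.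
  have sV := smooth_charts_invmx oT upit spit.
  apply: (smooth_charts_congr oT _ (smooth_charts_mulmx oT sA sV)) => c x ac _ dx /=.
  set J := tangent_coord c x; have uJx : J \in unitmx by exact: uJ.
  have uJT : J^T \in unitmx by rewrite unitmx_tr.
  have -> : invmx (J^T *m pit x *m J) = invmx J *m invmx (pit x) *m (invmx J)^T.
    have h : (J^T *m pit x *m J) *m (invmx J *m invmx (pit x) *m (invmx J)^T) = 1%:M.
      rewrite !mulmxA mulmxK// mulmxK//.
      by rewrite -trmx_mul mulVmx// trmx1.
    have u := upit c x ac I dx.
    by rewrite -[RHS](mulKmx u) h mulmx1.
  by rewrite /B !mulmxA mulmxK.
have [E' [L' [hE' hI hR]]] := bfield_transform_transverse sB xB.
exists E', L'; split=> //.
pose Phi' x := bfield (- B x) *m Phi x *m bfield (B x).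
pose theta x := ursubmx (Phi' x).
have blocks' x := represents_blocks hR x.
have [_ _ _ st _] := represents_smooth hR.
have A0 x : ulsubmx (Phi' x) = 0.
  have [PE _ _ _ _] := blocks x.
  by rewrite /Phi' PE bfield_conj block_mxKul Bp subrr.
have pE x : dlsubmx (Phi' x) = p x.
  by have [PE _ _ _ _] := blocks x; rewrite /Phi' PE bfield_conj block_mxKdl.
have tT x : (theta x)^T = - theta x by have [_ []] := blocks' x.
have xt x : xi x *m theta x = 0 by have [_ _ []] := blocks' x.
have ex x : ev (eta x) (xi x) = 1 by have [_ _ []] := blocks' x.
have tp x : theta x *m p x = - 1%:M + (eta x)^T *m xi x.
  have [_ _ _ [h _] _] := blocks' x; move: h.
  by rewrite -/(Phi' x) A0 mulmx0 add0r pE.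
have PE' x : Phi' x = block_mx 0 (theta x) (p x) 0.
  have [h _ _ _ _] := blocks' x; move: h.
  by rewrite -/(Phi' x) A0 pE trmx0 oppr0.
exists theta, eta, Phi', (fun x => row_mx (xi x) 0), (fun x => row_mx 0 (eta x)).
split; last exact: hR.
  split=> // x.
  pose h := linfun (mulmxr (eta x)^T : 'rV[R]_m -> 'rV[R]_1).
  have memW X : X \in lker h <-> ev (eta x) X = 0.
    rewrite memv_ker lfunE /= mul_tr_ev; split=> [/eqP/matrixP/(_ 0 0)|->].
      by rewrite !mxE.
    by rewrite raddf0.
  have dW : (n * 2 <= \dim (lker h))%N.
    have dimrV r : dim 'rV[R]_r = r by rewrite /dim /= mul1n.
    have := limg_ker_dim h fullv; rewrite capfv dimvf dimrV => kerE.
    have : (\dim (limg h) <= 1)%N.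
      by apply: leq_trans (dimvS (subvf _)) _; rewrite dimvf dimrV.
    by lia.
  have [|f [fW fJ]] := symplectic_family (tT x) dW; last first.
    by apply: (wedge_pow_form1 fJ _ (ex x)) => i; apply/memW.
  move=> X /memW eX Xt.
  have Xt0 : X *m theta x = 0.
    apply/rowP => i; rewrite [RHS]mxE.
    (* The projection on Ker eta along xi, which spans the kernel of theta. *)
    pose Y := delta_mx 0 i - ev (eta x) (delta_mx 0 i) *: xi x.
    have YW : Y \in lker h by apply/memW; rewrite evDr evNr evZr ex mulr1 subrr.
    have := Xt Y YW; rewrite /Y evDr evNr evZr (evC _ (xi x)) ev_mul tT mulmxN xt oppr0 ev0l.
    by rewrite mulr0 subr0 evC /ev trmx_delta -colE mxE.
  have := congr1 (mulmx^~ (p x)) Xt0; rewrite /= mul0mx -mulmxA tp mulmxDr mul_rank1 eX.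
  by rewrite scale0r addr0 mulmxN mulmx1 => /eqP; rewrite oppr_eq0 => /eqP.
have [_ _ _ _ hx] := hR.1.
exists xi; split; [exact: sx|by []|move=> x].
have [_ P1 P2 _] := hx x; split=> // X Y alpha eX eY ax Yt.
rewrite PE' mul_row_block !mulmx0 addr0 add0r -Yt -mulmxA tp mulmxDr mul_rank1 eY.
by rewrite scale0r addr0 mulmxN mulmx1.
Qed.

(** Here p = 0, and so A is an almost contact endomorphism, A^2 = - 1 + eta^T
   xi. The B-field transformation replaces the 2-form s by s + A B + B A^T,
   and for B = A s / 2 the two added terms are both - s / 2, because A s = s
   A^T and i_xi s = 0. *)
Lemma almost_contact_form n : m = (2 * n).+1 -> (forall x, type_t L x = n.+1) ->
  exists E' L', [/\ gen_almost_contact E' L', isomorphic E L E' L' &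
    exists phi xi eta Phi e1 e2,
      [/\ almost_contact phi xi eta,
          triple_of_almost_contact phi xi eta Phi e1 e2 &
          represents Phi e1 e2 E' L']].
Proof.
move=> mE t1; have oT : open [set: M] by exact: openT.
have p0 x : p x = 0.
  apply: bivector_zero (blocks x) _ _; first by move=> u; exact: (hP.2 x).2.
  have [h1 [h2 h3]] := type_dims x; rewrite t1 in h1.
  by move: h2; rewrite -/(cotangent x); lia.
have [sx se sA ss _] := represents_smooth hP.
pose B x := 2^-1 *: (A x *m s x).
have xB x : xi x *m B x = 0.
  by have [_ _ [_ xA _ _ _] _ _] := blocks x; rewrite /B -scalemxAr mulmxA xA mul0mx scaler0.
have AA x : A x *m A x = - 1%:M + (eta x)^T *m xi x.
  by have [_ _ _ [h _] _] := blocks x; rewrite -h p0 mulmx0 addr0.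
have sB : smooth_two_form B.
  split=> [x|].
    have [_ [sT _] _ _ [As _]] := blocks x.
    by rewrite /B linearZ /= trmx_mul sT mulNmx -As scalerN.
  apply: (smooth_charts_congr oT _ (smooth_charts_scale oT 2^-1 (smooth_charts_mulmx oT sA ss))) => c x ac _ dx /=.
  by rewrite /B -scalemxAr -scalemxAl !mulmxA mulmxK//; exact: tangent_coord_unit.
have [E' [L' [hE' hI hR]]] := bfield_transform_transverse sB xB.
exists E', L'; split=> //.
pose Phi' x := bfield (- B x) *m Phi x *m bfield (B x).
have PE' x : Phi' x = block_mx (A x) 0 0 (- (A x)^T).
  have [PE _ [_ _ xs _ _] _ [As _]] := blocks x.
  rewrite /Phi' PE bfield_conj p0 mulmx0 subr0 mul0mx add0r; congr block_mx.
  rewrite /B -scalemxAr -scalemxAl mulmxN scalerN opprK mulmxA AA.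
  rewrite -mulmxA -As mulmxA AA mulmxDl mulNmx mul1mx -mulmxA xs mulmx0 addr0.
  rewrite scalerN addrCA -opprD -scalerDl.
  by rewrite (_ : 2^-1 + 2^-1 = 1 :> R) ?scale1r ?subrr//; field.
exists A, xi, eta, Phi', (fun x => row_mx (xi x) 0), (fun x => row_mx 0 (eta x)).
split; last exact: hR.
  split=> // x; have [_ _ [ex xA _ _ eA] _ _] := blocks x; split=> // X.
  by rewrite -mulmxA AA mulmxDr mulmxN mulmx1 mul_rank1.
move=> x; split=> // X alpha.
by rewrite PE' mul_row_block !mulmx0 addr0 add0r mulmxN.
Qed.

End TransverseBField.

Theorem theorem10 (R : realType) (n : nat) (M : manifold R (2 * n).+1)
    (E : M -> {vspace 'rV[R]_((2 * n).+1 + (2 * n).+1)})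
    (L : M -> {vspace 'rV[R[i]]_((2 * n).+1 + (2 * n).+1)})
    (hEL : gen_almost_contact E L)
    (hp : forall x, type_p E x = 1%N) :
  [/\ exists E' L',
        [/\ gen_almost_contact E' L', isomorphic E L E' L' &
            exists Phi e1 e2,
              poon_wade_triple Phi e1 e2 /\ represents Phi e1 e2 E' L'],
      (forall x, type_t L x = 1%N) ->
      exists E' L',
        [/\ gen_almost_contact E' L', isomorphic E L E' L' &
            exists theta eta Phi e1 e2,
              [/\ almost_cosymplectic n theta eta,
                  triple_of_almost_cosymplectic theta eta Phi e1 e2 &
                  represents Phi e1 e2 E' L']] &
      (forall x, type_t L x = n.+1) ->
      exists E' L',
        [/\ gen_almost_contact E' L', isomorphic E L E' L' &
            exists phi xi eta Phi e1 e2,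
              [/\ almost_contact phi xi eta,
                  triple_of_almost_contact phi xi eta Phi e1 e2 &
                  represents Phi e1 e2 E' L']]].
Proof.
have [E1 [L1 [Phi [xi [eta [hE1 hI1 hR1 ht1]]]]]] := poon_wade_form hEL hp.
split.
- exists E1, L1; split=> //.
  exists Phi, (fun x => row_mx (xi x) 0), (fun x => row_mx 0 (eta x)).
  split; last exact: hR1.
  by split=> [|x]; [exact: hR1.1|rewrite row_mxKr row_mxKl].
- move=> t1; have t1' x : type_t L1 x = 1%N by rewrite ht1.
  have [E2 [L2 [hE2 hI2 h]]] := almost_cosymplectic_form hE1 hR1 erefl t1'.
  by exists E2, L2; split=> //; exact: isomorphic_trans hI1 hI2.
- move=> t1; have t1' x : type_t L1 x = n.+1 by rewrite ht1.
  have [E2 [L2 [hE2 hI2 h]]] := almost_contact_form hE1 hR1 erefl t1'.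
  by exists E2, L2; split=> //; exact: isomorphic_trans hI1 hI2.
Qed.
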